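(* There exist a compact geodesic metric space $X$ and a family $\{\mu_w\}_{w\in(0,1)}$ of doubling Borel probability measures on $X$ such that: (i) for each $w\in(0,1)$ the metric measure space $(X,\mu_w)$ supports a $(1,1)$-Poincar\'e inequality; (ii) for all $w,w'\in(0,1)$ with $w\neq w'$, the measures $\mu_w$ and $\mu_{w'}$ are mutually singular.
   Context: A Borel measure $\mu$ on a metric space $X$ is doubling if there is $C\ge 1$ such that $0<\mu(B(x,2r))\le C\,\mu(B(x,r))<\infty$ for all $x\in X$ and $r>0$. A metric measure space $(X,\mu)$ supports a $(1,1)$-Poincar\'e inequality (in the sense of Heinonen--Koskela) if there are constants $C>0$ and $\lambda\ge 1$ such that for every open ball $B=B(x,r)$, every function $u$ that is integrable on balls, and every upper gradient $\rho\ge 0$ of $u$ (a Borel function with $|u(\gamma(a))-u(\gamma(b))|\le\int_\gamma \rho\,ds$ for every rectifiable curve $\gamma:[a,b]\to X$), one has $\frac{1}{\mu(B)}\int_B |u-u_B|\,d\mu \le C\,r\,\frac{1}{\mu(\lambda B)}\int_{\lambda B}\rho\,d\mu$, where $u_B=\frac{1}{\mu(B)}\int_B u\,d\mu$ and $\lambda B=B(x,\lambda r)$. Two measures are mutually singular if there is a Borel set of full measure for one and zero measure for the other. *)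

(* Defs.v *)
From HB Require Import structures.
From mathcomp Require Import all_boot all_order all_algebra.
From mathcomp Require Import all_classical all_reals all_analysis.
From mathcomp Require Import measurable_realfun.
Set Implicit Arguments. Unset Strict Implicit. Unset Printing Implicit Defensive.
Import Order.TTheory GRing.Theory Num.Theory.
Local Open Scope classical_set_scope.
Local Open Scope ring_scope.

Section MetricDefs.
Context {R : realType} {X : Type}.
Implicit Types (dist : X -> X -> R).

Definition is_metric dist : Prop :=
  [/\ forall x y, dist x y = 0 <-> x = y,
      forall x y, dist x y = dist y x &
      forall x y z, dist x z <= dist x y + dist y z].

Definition mball dist (x : X) (r : R) : set X := [set y | dist x y < r].

Definition mopen dist (O : set X) : Prop :=
  forall x, O x -> exists2 r : R, 0 < r & mball dist x r `<=` O.

Definition mcompact dist : Prop :=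
  forall (I : Type) (U : I -> set X),
    (forall i, mopen dist (U i)) -> setT `<=` \bigcup_i U i ->
    exists2 F : set I, finite_set F & setT `<=` \bigcup_(i in F) U i.

Definition mgeodesic dist : Prop :=
  forall x y, exists g : R -> X,
    [/\ g 0 = x, g (dist x y) = y &
        forall s t, 0 <= s <= dist x y -> 0 <= t <= dist x y ->
          dist (g s) (g t) = `|s - t|].

Definition curve_length dist (g : R -> X) (s t : R) : \bar R :=
  ereal_sup [set (\sum_(i < size q)
                    dist (g (nth s (s :: q) i)) (g (nth s q i)))%:E
            | q in [set q : seq R | sorted <=%R (s :: q) /\ last s q = t]].

Definition arclength_param dist (g : R -> X) (L : R) : Prop :=
  forall s t, 0 <= s -> s <= t -> t <= L ->
    curve_length dist g s t = (t - s)%:E.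

(* line integral of rho along an arc-length parametrized curve g : [0,L] -> X *)
Definition line_integral (g : R -> X) (L : R) (rho : X -> \bar R) : \bar R :=
  (\int[lebesgue_measure]_(t in [set t : R | (0 <= t <= L)%R]) rho (g t))%E.

(* rho is an upper gradient of u: tested on every rectifiable curve, i.e.
   (after arc-length reparametrization) on every arc-length parametrized
   curve g : [0,L] -> X *)
Definition upper_gradient dist (u : X -> R) (rho : X -> \bar R) : Prop :=
  forall (g : R -> X) (L : R), 0 <= L -> arclength_param dist g L ->
    (`|u (g 0) - u (g L)|%:E <= line_integral g L rho)%E.
End MetricDefs.

Section MeasureDefs.
Context {R : realType} {d : measure_display} {X : measurableType d}.

Definition borel_for (dist : X -> X -> R) : Prop :=
  (@measurable d X) = <<s [set O : set X | mopen dist O] >>.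

Definition doubling (dist : X -> X -> R) (mu : {measure set X -> \bar R}) : Prop :=
  exists2 C : R, 1 <= C & forall (x : X) (r : R), 0 < r ->
    (0 < mu (mball dist x (2 * r)) /\
     mu (mball dist x (2 * r)) <= C%:E * mu (mball dist x r) /\
     C%:E * mu (mball dist x r) < +oo)%E.

Definition ball_mean (mu : {measure set X -> \bar R}) (B : set X) (u : X -> R) : R :=
  fine (\int[mu]_(y in B) (u y)%:E)%E / fine (mu B).

(* (1,1)-Poincare inequality in the sense of Heinonen--Koskela *)
Definition poincare11 (dist : X -> X -> R) (mu : {measure set X -> \bar R}) : Prop :=
  exists C : R, exists2 lam : R, 0 < C /\ 1 <= lam &
    forall (x : X) (r : R), 0 < r ->
    forall u : X -> R,
      (forall (z : X) (s : R), 0 < s -> mu.-integrable (mball dist z s) (EFin \o u)) ->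
    forall rho : X -> \bar R,
      (forall y, (0 <= rho y)%E) -> measurable_fun [set: X] (rho : X -> \bar R) ->
      upper_gradient dist u rho ->
      let B := mball dist x r in
      let lB := mball dist x (lam * r) in
      ((fine (mu B))^-1%:E *
         \int[mu]_(y in B) (`|u y - ball_mean mu B u|)%:E
       <= (C * r / fine (mu lB))%:E * \int[mu]_(y in lB) rho y)%E.

Definition mutually_singular (mu nu : {measure set X -> \bar R}) : Prop :=
  exists A : set X, [/\ measurable A, mu (~` A) = 0%E & nu A = 0%E].
End MeasureDefs.

(* Main.v *)
(* The space is a Laakso space: [0, 1] x {0,1}^N where, at every height
   t = (2j+1)/2^(k+1) (a worm hole of level k), the two values of the k-th digit
   are identified.  A point (s, a) reaches (t, b) by a vertical path covering an
   interval [p, q] that contains s, t and a worm hole of each level where a and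
   b differ, so the geodesic distance is the least 2(q - p) - |s - t|.  The
   measure mu_w is the image of Lebesgue x Bernoulli(w)^N.

   A ball of radius r is comparable to a box I x C, where C fixes the digits of
   the levels without a worm hole in I; doubling holds because halving r fixes
   at most five more digits.  For the Poincare inequality on I x C, join (s, a)
   to the bottom p of I, then go up to the top q while switching the k-th digit
   from a_k to b_k at the first worm hole of level k.  At each height h of this
   path, if a and b are independent and Bernoulli(w) distributed then so is the
   current digit sequence, so averaging over a, b and s bounds the
   oscillation of u by |I| times the integral of the upper gradient, without any
   Riesz kernel; some fixed b then does as well as the average, up to epsilon.

   The laws Bernoulli(w)^N for different w are mutually singular since the
   Hellinger affinity of their first n digits is the n-th power of a number < 1
   (Borel-Cantelli). *)
Require Import Defs.
From HB Require Import structures.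
From mathcomp Require Import all_boot all_order all_algebra.
From mathcomp Require Import all_classical all_reals all_analysis.
From mathcomp Require Import measurable_realfun.
From mathcomp Require Import lra zify ring.
Set Implicit Arguments. Unset Strict Implicit. Unset Printing Implicit Defensive.
Import Order.TTheory GRing.Theory Num.Theory numFieldNormedType.Exports.
Local Open Scope classical_set_scope.
Local Open Scope ring_scope.

(** * The Laakso space and its distance *)

Section Laakso.
Context {R : realType}.
Implicit Types (s t p q h z : R) (a b : nat -> bool) (k : nat).

(** These heights are the midpoints of the dyadic intervals of length 2^-k, so worm holes of
    different levels never share a height. *)
Definition worm k z : Prop :=
  exists2 j : nat, (j < 2 ^ k)%N & z = (j.*2.+1)%:R / 2 ^+ k.+1.

Definition hit k p q : Prop := exists2 z, worm k z & p <= z <= q.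

Lemma worm01 k z : worm k z -> 0 <= z <= 1.
Proof.
move=> [j jk ->]; apply/andP; split; first by rewrite divr_ge0 ?exprn_ge0.
by rewrite ler_pdivrMr ?exprn_gt0// mul1r -natrX ler_nat expnS; lia.
Qed.

Lemma hit_pt k t : hit k t t -> worm k t.
Proof. by move=> [z wz zt]; rewrite (_ : t = z)//; lra. Qed.

Lemma hit_sub k p q p' q' : p' <= p -> q <= q' -> hit k p q -> hit k p' q'.
Proof. by move=> ? ? [z ? ?]; exists z => //; lra. Qed.

Lemma hit01 k : hit k 0 1.
Proof.
have w : worm k (1 / 2 ^+ k.+1) by exists 0%N; rewrite ?expn_gt0//.
by exists (1 / 2 ^+ k.+1) => //; exact: worm01 w.
Qed.

Definition linked a b p q : Prop := forall k, a k != b k -> hit k p q.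

Definition feasible s a t b p q : Prop :=
  [/\ 0 <= p, p <= s /\ p <= t, s <= q /\ t <= q, q <= 1 & linked a b p q].

Definition rawdist s a t b : R :=
  inf [set c | exists p q, feasible s a t b p q /\ c = 2 * (q - p) - `|s - t|].

(** Level [k] has finitely many worm holes, and each contributes a closed quadrant of pairs (p, q).
    Closedness is what makes the infimum in [rawdist] attained. *)
Lemma closed_hit k : closed [set z : R * R | hit k z.1 z.2].
Proof.
rewrite (_ : mkset _ = \bigcup_(j in `I_(2 ^ k))
    [set z : R * R | z.1 <= (j.*2.+1)%:R / 2 ^+ k.+1 <= z.2]).
  apply: closed_bigcup; first exact: finite_II.
  move=> j _; set c := _ / _.
  rewrite (_ : mkset _ = (fst @^-1` [set x | x <= c]) `&`
      (snd @^-1` [set x | c <= x])); last first.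
    by apply/seteqP; split=> -[x y] /= => [/andP[]//|[-> ->]].
  by apply: closedI; apply: preimage_closed; [move=> ? _; exact: cvg_fst|
    exact: closed_le|move=> ? _; exact: cvg_snd|exact: closed_ge].
apply/seteqP; split=> -[x y] /=; first by move=> [z [j jk ->] ?]; exists j.
by move=> [j jk ?]; exists ((j.*2.+1)%:R / 2 ^+ k.+1) => //; exists j.
Qed.

(** The feasible pairs (p, q) form a compact subset of the plane, nonempty because [0, 1] meets
    every level, and the cost is continuous in (p, q). *)
Lemma rawdist_attained s a t b : 0 <= s <= 1 -> 0 <= t <= 1 ->
  exists p q, feasible s a t b p q /\ rawdist s a t b = 2 * (q - p) - `|s - t|.
Proof.
move=> s01 t01.
pose Z := (`[0, Num.min s t] `*` `[Num.max s t, 1]) `&`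
  \bigcap_(k in [set k | a k != b k]) [set z : R * R | hit k z.1 z.2].
have ZE p q : Z (p, q) <-> feasible s a t b p q.
  rewrite /Z /= !in_itv /= le_min ge_max; split.
    by move=> [[/andP[p0 /andP[ps pt]] /andP[/andP[sq tq] q1]] H]; split.
  by move=> [p0 [ps pt] [sq tq] q1 H]; rewrite p0 ps pt sq tq q1.
have cZ : compact Z.
  apply: compact_closedI.
    by apply: compact_setX; exact: segment_compact.
  by apply: closed_bigI => k _; exact: closed_hit.
have Z0 : Z !=set0.
  by exists (0, 1); apply/ZE; split; try lra; move=> k _; exact: hit01.
have cf : continuous (fun z : R * R => 2 * (z.2 - z.1) - `|s - t|).
  move=> z; apply: cvgB; last exact: cvg_cst.
  by apply: cvgM; [exact: cvg_cst|apply: cvgB; [exact: cvg_snd|exact: cvg_fst]].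
have [[p q] /set_mem Zpq minpq] :=
  compact_EVT_min Z0 cZ (continuous_subspaceT cf).
exists p, q; split; first exact/ZE.
apply/eqP; rewrite eq_le; apply/andP; split.
  apply: ge_inf; last by exists p, q; split => //; exact/ZE.
  by exists (2 * (q - p) - `|s - t|) => _ [p' [q' [/ZE/mem_set/minpq ? ->]]].
apply: lb_le_inf; last by move=> _ [p' [q' [/ZE/mem_set/minpq ? ->]]].
by exists (2 * (q - p) - `|s - t|), p, q; split => //; exact/ZE.
Qed.

Lemma rawdist_le s a t b p q : feasible s a t b p q ->
  rawdist s a t b <= 2 * (q - p) - `|s - t|.
Proof.
move=> F; apply: ge_inf; last by exists p, q.
exists 0 => _ /= [p' [q' [[p0 [ps pt] [sq tq] q1 H] ->]]].
by case: (lerP s t) => ?; lra.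
Qed.

(* Among identified points, the one whose digit at the worm hole is [false]. *)
Record laakso := MkLaakso {
  ht : R;
  dg : nat -> bool;
  laaksoP : 0 <= ht <= 1 /\ forall k, worm k ht -> dg k = false }.

Lemma laakso_eq (x y : laakso) : ht x = ht y -> dg x = dg y -> x = y.
Proof.
case: x y => [s a Pa] [t b Pb] /= st ab; subst.
by rewrite (Prop_irrelevance Pa Pb).
Qed.

Definition clamp t : R := Num.max 0 (Num.min 1 t).

Lemma clamp01 t : 0 <= clamp t <= 1.
Proof. by rewrite /clamp le_max lexx /= ge_max ler01 /= ge_min lexx. Qed.

Lemma clamp_id t : 0 <= t <= 1 -> clamp t = t.
Proof. by move=> /andP[t0 t1]; rewrite /clamp (min_r t1) max_r. Qed.

Definition bitmask t b k := b k && ~~ `[< worm k t >].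

Lemma bitmask_id t b k : ~ worm k t -> bitmask t b k = b k.
Proof. by move=> ?; rewrite /bitmask asboolF// andbT. Qed.

Lemma bitmask_worm t b k : worm k t -> bitmask t b k = false.
Proof. by move=> ?; rewrite /bitmask asboolT// andbF. Qed.

(** The quotient map, made total on [R]: heights are clamped to [0, 1], and the digit at a worm hole
    is erased to reach the chosen representative. *)
Definition lpt t b : laakso :=
  @MkLaakso (clamp t) (bitmask (clamp t) b)
    (conj (clamp01 t) (@bitmask_worm (clamp t) b)).

Lemma lpt_surj (x : laakso) : lpt (ht x) (dg x) = x.
Proof.
case: x => t b [t01 P]; apply: laakso_eq => /=; rewrite clamp_id//.
apply/funext => k; case: (pselect (worm k t)) => ?; last by rewrite bitmask_id.
by rewrite bitmask_worm// P.
Qed.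

Lemma ht01 (x : laakso) : 0 <= ht x <= 1. Proof. by case: (laaksoP x). Qed.

Lemma ht_lpt t b : 0 <= t <= 1 -> ht (lpt t b) = t.
Proof. by move=> ?; rewrite /= clamp_id. Qed.

Definition ldist (x y : laakso) : R := rawdist (ht x) (dg x) (ht y) (dg y).

Lemma ldistP x y : exists p q,
  feasible (ht x) (dg x) (ht y) (dg y) p q /\
  ldist x y = 2 * (q - p) - `|ht x - ht y|.
Proof. by apply: rawdist_attained; exact: ht01. Qed.

Lemma ldist_le x y p q : feasible (ht x) (dg x) (ht y) (dg y) p q ->
  ldist x y <= 2 * (q - p) - `|ht x - ht y|.
Proof. exact: rawdist_le. Qed.

(** Erasing alters a digit only at a level with a worm hole at [s] or [t], and such a level is hit
    by [p, q] anyway. *)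
Lemma linked_bitmask s a t b p q : p <= s <= q -> p <= t <= q ->
  linked (bitmask s a) (bitmask t b) p q <-> linked a b p q.
Proof.
move=> ps pt; split=> L k abk.
- have [ws|ws] := pselect (worm k s); first by exists s.
  have [wt|wt] := pselect (worm k t); first by exists t.
  by apply: L; rewrite !bitmask_id.
- have [ws|ws] := pselect (worm k s); first by exists s.
  have [wt|wt] := pselect (worm k t); first by exists t.
  by apply: L; rewrite !bitmask_id in abk.
Qed.

Lemma feasible_lpt s a t b p q : 0 <= s <= 1 -> 0 <= t <= 1 ->
  feasible (ht (lpt s a)) (dg (lpt s a)) (ht (lpt t b)) (dg (lpt t b)) p q <->
  feasible s a t b p q.
Proof.
move=> s01 t01; rewrite /= !clamp_id//; split=> -[p0 [ps pt] [sq tq] q1 L];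
  by split => //; move: L; rewrite linked_bitmask//; apply/andP.
Qed.

Lemma ldist_lptP s a t b : 0 <= s <= 1 -> 0 <= t <= 1 -> exists p q,
  feasible s a t b p q /\ ldist (lpt s a) (lpt t b) = 2 * (q - p) - `|s - t|.
Proof.
move=> s01 t01; have [p [q [F E]]] := ldistP (lpt s a) (lpt t b).
exists p, q; rewrite E !ht_lpt//; split=> //.
by move/feasible_lpt : F; exact.
Qed.

Lemma ldist_lpt_le s a t b p q : 0 <= s <= 1 -> 0 <= t <= 1 ->
  feasible s a t b p q ->
  ldist (lpt s a) (lpt t b) <= 2 * (q - p) - `|s - t|.
Proof.
move=> s01 t01 /(feasible_lpt a b p q s01 t01)/ldist_le.
by rewrite !ht_lpt.
Qed.

Lemma ldist_ge_ht x y : `|ht x - ht y| <= ldist x y.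
Proof.
have [p [q [[p0 [ps pt] [sq tq] q1 L] ->]]] := ldistP x y.
by case: (lerP (ht x) (ht y)) => ?; lra.
Qed.

Lemma ldist_ge0 x y : 0 <= ldist x y.
Proof. exact: le_trans (normr_ge0 _) (ldist_ge_ht x y). Qed.

Lemma ldistxx x : ldist x x = 0.
Proof.
apply/eqP; rewrite eq_le ldist_ge0 andbT.
have x01 := ht01 x.
have /ldist_le : feasible (ht x) (dg x) (ht x) (dg x) (ht x) (ht x).
  by split; try lra; move=> k; rewrite eqxx.
by rewrite subrr normr0 mulr0 subr0.
Qed.

Lemma ldist_sym x y : ldist x y = ldist y x.
Proof.
suff le u v : ldist u v <= ldist v u by apply/eqP; rewrite eq_le !le.
have [p [q [[p0 [ps pt] [sq tq] q1 L] ->]]] := ldistP v u.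
rewrite distrC; apply: ldist_le; split=> // k; rewrite eq_sym; exact: L.
Qed.

(** Both intervals contain [ht y], so the interval they span costs no more than the two together. A
    level where x and z differ is one where x and y, or y and z, differ. *)
Lemma ldist_tri x y (z : laakso) : ldist x z <= ldist x y + ldist y z.
Proof.
have [p [q [[p0 [ps pt] [sq tq] q1 L] ->]]] := ldistP x y.
have [p' [q' [[p0' [ps' pt'] [sq' tq'] q1' L'] ->]]] := ldistP y z.
have : feasible (ht x) (dg x) (ht z) (dg z) (Num.min p p') (Num.max q q').
  split; rewrite ?le_min ?ge_min ?le_max ?ge_max ?p0 ?p0' ?q1 ?q1' ?ps ?pt'
    ?sq ?tq' ?orbT//.
  move=> k xzk; have [xy|xy] := eqVneq (dg x k) (dg y k).
    rewrite xy in xzk; apply: hit_sub (L' k xzk).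
      by rewrite ge_min lexx orbT.
    by rewrite le_max lexx orbT.
  apply: hit_sub (L k xy); first by rewrite ge_min lexx.
  by rewrite le_max lexx.
move/ldist_le => /le_trans; apply.
by case: (leP p p') => ?; case: (leP q q') => ?;
 case: (lerP (ht x) (ht z)) => ?; case: (lerP (ht x) (ht y)) => ?;
 case: (lerP (ht y) (ht z)) => ?; lra.
Qed.

(** Zero cost collapses the interval to a single height; a differing digit would then sit at a worm
    hole, where both points carry [false]. *)
Lemma ldist_metric : is_metric ldist.
Proof.
split; [move=> x y; split=> [|->]|exact: ldist_sym|exact: ldist_tri];
  last exact: ldistxx.
have [p [q [[p0 [ps pt] [sq tq] q1 L] ->]]] := ldistP x y => E.
have [xp yp qp] : [/\ ht x = p, ht y = p & q = p].
  by move: E; case: (lerP (ht x) (ht y)) => ? ?; split; lra.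
apply: laakso_eq; first by rewrite xp yp.
apply/funext => k; apply/eqP; apply: contraT => xyk.
have wk : worm k p by move: (L k xyk); rewrite qp => /hit_pt.
by move: xyk; rewrite (proj2 (laaksoP x)) ?xp// (proj2 (laaksoP y)) ?yp.
Qed.

(** * Vertical paths that switch digits at worm holes, and geodesics *)

Definition mix p a b h k := if `[< hit k p h >] then b k else a k.

Lemma mix_same p a h : mix p a a h = a.
Proof. by apply/funext => k; rewrite /mix; case: ifP. Qed.

Lemma mixT p a b h k : hit k p h -> mix p a b h k = b k.
Proof. by move=> ?; rewrite /mix asboolT. Qed.

Lemma mixF p a b h k : ~ hit k p h -> mix p a b h k = a k.
Proof. by move=> ?; rewrite /mix asboolF. Qed.

Lemma linked_eq s a b : linked a b s s -> 0 <= s <= 1 -> lpt s a = lpt s b.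
Proof.
move=> L s01; apply: laakso_eq => //=; rewrite clamp_id//.
apply/funext => k; have [ws|ws] := pselect (worm k s).
  by rewrite !bitmask_worm.
by rewrite !bitmask_id//; apply/eqP; apply: contraT => /L/hit_pt.
Qed.

Lemma lpt_mix_start p a b : 0 <= p <= 1 -> lpt p (mix p a b p) = lpt p a.
Proof.
move=> p01; apply: linked_eq => // k.
by have [//|/mixF->] := pselect (hit k p p); rewrite eqxx.
Qed.

(** A digit that changes between [h] and [h'] has a worm hole in between, so [h, h'] itself is
    feasible; the height difference is the matching lower bound. *)
Lemma lpt_mix_dist p a b h h' : 0 <= p -> p <= h -> h <= h' -> h' <= 1 ->
  ldist (lpt h (mix p a b h)) (lpt h' (mix p a b h')) = h' - h.
Proof.
move=> p0 ph hh' h'1; have h01 : 0 <= h <= 1 by lra.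
have h'01 : 0 <= h' <= 1 by lra.
apply/eqP; rewrite eq_le; apply/andP; split; last first.
  apply: le_trans (ldist_ge_ht _ _); rewrite !ht_lpt//.
  by rewrite distrC ger0_norm ?subr_ge0.
have /ldist_lpt_le : feasible h (mix p a b h) h' (mix p a b h') h h'.
  split; try lra; move=> k.
  have [H|H] := pselect (hit k p h).
    by rewrite !mixT ?eqxx//; apply: hit_sub H.
  have [[z wz zz]|H'] := pselect (hit k p h'); last by rewrite !mixF ?eqxx.
  move=> _; exists z => //; have [//|zh] := leP h z; first lra.
  by exfalso; apply: H; exists z => //; lra.
by rewrite distrC (ger0_norm (_ : 0 <= h' - h)) ?subr_ge0// => /(_ h01 h'01); lra.
Qed.

(** Only a 1-Lipschitz bound is asked, because it survives concatenation; when [L] is the distance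
    of the ends, isometry comes for free. *)
Definition walk (x y : laakso) (L : R) : Prop := 0 <= L /\ exists g : R -> laakso,
  [/\ g 0 = x, g L = y & forall s t, 0 <= s <= L -> 0 <= t <= L ->
    ldist (g s) (g t) <= `|s - t|].

Lemma walk_sym x y L : walk x y L -> walk y x L.
Proof.
move=> [L0 [g [g0 gL g1]]]; split=> //; exists (fun t => g (L - t)).
rewrite subr0 subrr; split=> // s t sL tL.
have := g1 (L - s) (L - t); rewrite (_ : L - s - (L - t) = t - s); last ring.
by rewrite [`|t - s|]distrC; apply; clear -sL tL; lra.
Qed.

Lemma walk_cat x y (z : laakso) L M : walk x y L -> walk y z M -> walk x z (L + M).
Proof.
move=> [L0 [g [g0 gL g1]]] [M0 [f [f0 fM f1]]]; split; first lra.
exists (fun t => if t <= L then g t else f (t - L)); rewrite L0; split=> //.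
  case: ifPn => [LM|_]; last by rewrite addrAC subrr add0r.
  have M0' : M = 0 by lra.
  by rewrite M0' addr0 gL -f0 -fM M0'.
have key s t : 0 <= s <= L -> L <= t <= L + M ->
    ldist (g s) (f (t - L)) <= t - s.
  move=> sL tL; apply: le_trans (ldist_tri _ y _) _.
  have : ldist (g s) y <= `|s - L| by rewrite -gL; apply: g1; lra.
  have : ldist y (f (t - L)) <= `|0 - (t - L)| by rewrite -f0; apply: f1; lra.
  by rewrite sub0r normrN (ger0_norm (_ : 0 <= t - L)) 1?distrC
    ?(ger0_norm (_ : 0 <= L - s)); lra.
move=> s t s0 t0.
case: (leP s L) => sL; case: (leP t L) => tL.
- by apply: g1; lra.
- by apply: le_trans (key _ _ _ _) _; [lra|lra|
    rewrite distrC ger0_norm; lra].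
- by rewrite ldist_sym; apply: le_trans (key _ _ _ _) _; [lra|lra|
    rewrite ger0_norm; lra].
- apply: le_trans (f1 _ _ _ _) _; [lra|lra|].
  by rewrite (_ : s - L - (t - L) = s - t)//; ring.
Qed.

Lemma walk_up p q a b : 0 <= p -> p <= q -> q <= 1 -> linked a b p q ->
  walk (lpt p a) (lpt q b) (q - p).
Proof.
move=> p0 pq q1 L; split; first lra.
exists (fun t => lpt (p + t) (mix p a b (p + t))); split.
- by rewrite addr0 lpt_mix_start//; lra.
- rewrite addrC subrK; apply: linked_eq; last lra.
  move=> k; have [H|H] := pselect (hit k p q); first by rewrite mixT ?eqxx.
  by rewrite mixF// => /L.
- move=> s t s0 t0; wlog st : s t s0 t0 / s <= t => [W|].
    case: (leP s t) => [/W|/ltW/W]; first exact.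
    by rewrite ldist_sym distrC; exact.
  rewrite lpt_mix_dist; try lra.
  by rewrite distrC ger0_norm; lra.
Qed.

Lemma walk_straight p q a : 0 <= p -> p <= q -> q <= 1 ->
  walk (lpt p a) (lpt q a) (q - p).
Proof. by move=> ? ? ?; apply: walk_up => // k; rewrite eqxx. Qed.

(** With x the lower point and [p, q] optimal: descend to p with the digits of x, climb to q while
    switching to those of y, then descend to y. The three lengths add up to 2(q - p) - |ht x - ht
    y|. *)
Lemma walk_ldist x y : walk x y (ldist x y).
Proof.
wlog xy : x y / ht x <= ht y => [W|].
  have [/W//|/ltW/W] := leP (ht x) (ht y).
  by rewrite ldist_sym; exact: walk_sym.
have [p [q [[p0 [ps pt] [sq tq] q1 L] ->]]] := ldistP x y.
have W1 := walk_sym (walk_straight (dg x) p0 ps (proj2 (andP (ht01 x)))).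
have W2 := walk_up p0 (le_trans ps sq) q1 L.
have W3 := walk_sym (walk_straight (dg y) (proj1 (andP (ht01 y))) tq q1).
have := walk_cat (walk_cat W1 W2) W3.
rewrite !lpt_surj distrC ger0_norm ?subr_ge0//.
by congr walk; ring.
Qed.

(** If a 1-Lipschitz curve of length d(x, y) contracted some pair of parameters, the triangle
    inequality along x, [g s], [g t], y would make d(x, y) too small. *)
Lemma ldist_geodesic : mgeodesic ldist.
Proof.
move=> x y; have [L0 [g [g0 gL g1]]] := walk_ldist x y.
exists g; split=> // s t.
wlog st : s t / s <= t => [W|].
  have [/W//|/ltW/W H sL tL] := leP s t.
  by rewrite ldist_sym distrC H.
move=> s0 t0; apply/eqP; rewrite eq_le g1//=.
have := ldist_tri x (g s) y; have := ldist_tri (g s) (g t) y.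
have : ldist x (g s) <= s.
  by have := g1 0 s; rewrite g0 sub0r normrN ger0_norm; [apply; lra|lra].
have : ldist (g t) y <= ldist x y - t.
  have := g1 t (ldist x y); rewrite gL distrC ger0_norm; last lra.
  by apply; lra.
by rewrite distrC (ger0_norm (_ : 0 <= t - s)); lra.
Qed.

End Laakso.

(** * Dyadic boxes, compactness and balls *)

Section Dyadic.
Context {R : realType}.
Implicit Types (s t p q h : R) (a b : nat -> bool) (k : nat).

Definition dy (n j : nat) : R := j%:R / 2 ^+ n.

Lemma dy_double n j : dy n.+1 j.*2 = dy n j.
Proof. by rewrite /dy exprS -muln2 natrM; field. Qed.

Lemma dyS n j : dy n j.+1 = dy n j + 1 / 2 ^+ n.
Proof. by rewrite /dy -natr1 mulrDl. Qed.

Lemma dyD n m j : dy (n + m) (j * 2 ^ m) = dy n j.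
Proof. by rewrite /dy exprD natrM natrX; field; rewrite ?expf_neq0. Qed.

Lemma dy_le n i j : (dy n i <= dy n j) = (i <= j)%N.
Proof. by rewrite /dy ler_pM2r ?invr_gt0 ?exprn_gt0// ler_nat. Qed.

Lemma dy_ge0 n j : 0 <= dy n j.
Proof. by rewrite /dy divr_ge0 ?exprn_ge0. Qed.

Lemma dy_le1 n j : (dy n j <= 1) = (j <= 2 ^ n)%N.
Proof. by rewrite /dy ler_pdivrMr ?exprn_gt0// mul1r -natrX ler_nat. Qed.

Lemma dyadic_cover n t : 0 <= t <= 1 ->
  exists2 j, (j < 2 ^ n)%N & dy n j <= t <= dy n j.+1.
Proof.
move=> t01; elim: n => [|n [j jn tj]].
  by exists 0%N; rewrite // /dy expr0 !divr1.
rewrite -(dy_double _ j) -(dy_double _ j.+1) doubleS in tj.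
have [tm|mt] := leP t (dy n.+1 j.*2.+1).
- by exists j.*2; [rewrite expnS; lia|lra].
- by exists j.*2.+1; [rewrite expnS; lia|lra].
Qed.

Lemma hit_dyadic n k j : (n <= k)%N -> (j < 2 ^ n)%N ->
  hit k (dy n j) (dy n j.+1).
Proof.
move=> nk jn; have [m ->] : exists m, k = (n + m)%N by exists (k - n)%N; lia.
(* The midpoint of the first dyadic interval of generation n + m inside the given one. *)
exists (dy (n + m).+1 (j * 2 ^ m).*2.+1).
  exists (j * 2 ^ m)%N => //.
  by rewrite expnD ltn_pmul2r ?expn_gt0.
rewrite -(dyD n m j) -(dyD n m j.+1) -!(dy_double (n + m)) !dy_le.
have : (0 < 2 ^ m)%N by rewrite expn_gt0.
by rewrite mulSn; lia.
Qed.

Lemma hit_long k p q : 0 <= p -> q <= 1 -> p + 2 / 2 ^+ k <= q -> hit k p q.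
Proof.
move=> p0 q1 pq.
have e0 : 0 < 2 / 2 ^+ k :> R by rewrite divr_gt0 ?exprn_gt0.
have [|j jk /andP[jp pj]] := @dyadic_cover k p; first lra.
(* The dyadic interval following the one that contains [p] lies inside [p, q]. *)
have E : dy k j.+2 = dy k j + 2 / 2 ^+ k.
  by rewrite !dyS -addrA -mulrDl.
have : (j.+2 <= 2 ^ k)%N by rewrite -dy_le1 E; lra.
by move/(hit_dyadic (leqnn k)); apply: hit_sub => //; lra.
Qed.

(** Over the common denominator 2^(k'+1) the worm hole of the lower level has an even numerator and
    the other an odd one. *)
Lemma worm_sep k k' (z z' : R) : (k < k')%N -> worm k z -> worm k' z' ->
  1 / 2 ^+ k'.+1 <= `|z - z'|.
Proof.
move=> kk' [j jk ->] [j' jk' ->].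
have [m ->] : exists m, k' = (k.+1 + m)%N by exists (k' - k.+1)%N; lia.
rewrite -/(dy k.+1 j.*2.+1) -/(dy _ j'.*2.+1) -(dyD k.+1 m) -dy_double.
set i := (_ * _)%N; set l := (_ + m).+1.
have l0 : 0 < 1 / 2 ^+ l :> R by rewrite divr_gt0 ?exprn_gt0.
have [li|il] := leP i.*2 j'.*2.
  have : dy l i.*2.+1 <= dy l j'.*2.+1 by rewrite dy_le; lia.
  rewrite dyS => ?.
  by rewrite distrC ger0_norm ?subr_ge0; lra.
have : dy l j'.*2.+2 <= dy l i.*2 by rewrite dy_le; lia.
rewrite dyS => ?; by rewrite ger0_norm ?subr_ge0; lra.
Qed.

Lemma exp2_small (e : R) : 0 < e -> exists n : nat, 2 / 2 ^+ n < e.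
Proof.
move=> e0; exists (Num.Def.archi_bound (2 / e)).
rewrite ltr_pdivrMr ?exprn_gt0// mulrC -ltr_pdivrMr//.
exact: upper_nthrootP.
Qed.

Definition agree n a b := forall k, (k < n)%N -> a k = b k.

Definition dbox n j b : set laakso :=
  [set lpt t a | t in [set t | dy n j <= t <= dy n j.+1] &
                 a in [set a | agree n a b]].

(** Digits below [n] agree, and every level from [n] on has a worm hole in the dyadic interval, so
    that interval is feasible. *)
Lemma dbox_ldist n j b x y : (j < 2 ^ n)%N -> dbox n j b x -> dbox n j b y ->
  ldist x y <= 2 / 2 ^+ n.
Proof.
move=> jn [s /= sj [a' ab <-]] [t /= tj [b' bb <-]].
have j0 := dy_ge0 n j; have j1 : dy n j.+1 <= 1 by rewrite dy_le1.
have F : feasible s a' t b' (dy n j) (dy n j.+1).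
  split; try lra; move=> k; have [kn|nk] := ltnP k n.
    by rewrite ab// bb ?eqxx.
  by move=> _; exact: hit_dyadic.
have /= s01 : 0 <= s <= 1 by lra.
have /= t01 : 0 <= t <= 1 by lra.
apply: le_trans (ldist_lpt_le s01 t01 F) _; rewrite dyS.
by have := normr_ge0 (s - t); lra.
Qed.

Lemma dbox_cover n x : exists j b, (j < 2 ^ n)%N /\ dbox n j b x.
Proof.
have [j jn xj] := dyadic_cover n (ht01 x).
by exists j, (dg x); split=> //; exists (ht x) => //; exists (dg x);
  rewrite ?lpt_surj.
Qed.

Lemma lpt_dbox n j t a b : dy n j <= t <= dy n j.+1 -> agree n a b ->
  dbox n j b (lpt t a).
Proof. by move=> tj ab; exists t => //; exists a. Qed.

Lemma dbox_child n j b : (j < 2 ^ n)%N -> dbox n j b `<=`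
  \bigcup_(c in [set: bool * bool])
     dbox n.+1 (c.1 + j.*2)%N (fun k => if k == n then c.2 else b k).
Proof.
move=> jn _ [t /= tj [a ab <-]].
exists (dy n.+1 j.*2.+1 < t, a n) => //=; apply: lpt_dbox.
  rewrite -(dy_double _ j) -(dy_double _ j.+1) doubleS in tj.
  by case: ltP => ? /=; rewrite ?add0n ?add1n; lra.
move=> k kn; case: eqP => [->//|/eqP kn'].
by apply: ab; rewrite ltn_neqAle kn' -ltnS.
Qed.

(** Heine-Borel by bisection: a box without finite subcover has a child without one. The nested bad
    boxes shrink to a point, and the open set covering that point swallows a bad box. *)
Lemma ldist_compact : mcompact (@ldist R).
Proof.
move=> I U oU cU; apply: contrapT => nofin.
pose bad (z : nat * nat * (nat -> bool)) := (z.1.2 < 2 ^ z.1.1)%N /\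
  ~ exists2 F : set I, finite_set F &
      dbox z.1.1 z.1.2 z.2 `<=` \bigcup_(i in F) U i.
pose step (z z' : nat * nat * (nat -> bool)) := [/\ z'.1.1 = z.1.1.+1,
  (z'.1.2 = z.1.2.*2 \/ z'.1.2 = z.1.2.*2.+1) & agree z.1.1 z'.2 z.2].
have next z : exists z', bad z -> bad z' /\ step z z'.
  have [[zn nf]|] := pselect (bad z); last by exists z.
  case: z zn nf => -[n j] b /= zn nf.
  apply: contrapT => /forallNP nz'; apply: nf.
  have /choice[F Fc] (c : bool * bool) : exists F : set I, finite_set F /\
      dbox n.+1 (c.1 + j.*2)%N (fun k => if k == n then c.2 else b k) `<=`
      \bigcup_(i in F) U i.
    apply: contrapT => nF.
    apply: (nz' (n.+1, (c.1 + j.*2)%N, fun k => if k == n then c.2 else b k)).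
    move=> _; split; first split=> /=.
    - by rewrite expnS; case: (c.1); lia.
    - by move=> [F fF cF]; apply: nF; exists F.
    - split=> //=; first by case: (c.1); [right|left].
      by move=> k; case: eqP => // ->; rewrite ltnn.
  exists (\bigcup_(c in [set: bool * bool]) F c).
    by apply: bigcup_finite => // c _; have [] := Fc c.
  move=> x /(dbox_child zn)[c _ /(proj2 (Fc c))[i Fi Ui]].
  by exists i => //; exists c.
have [f fP] := choice next.
pose z n := iter n f (0%N, 0%N, fun=> false).
have z0 : bad (z 0%N).
  split=> //= -[F fF cF]; apply: nofin; exists F => // x _.
  apply: cF; have [j [b [j1 xb]]] := dbox_cover 0 x.
  case: xb => t; rewrite (_ : j = 0%N) => [tj [a ab <-]|].
    by apply: lpt_dbox.
  by move: j1; rewrite expn0; case: j.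
have zbad n : bad (z n) by elim: n => // n /fP[].
have zs n : step (z n) (z n.+1) by have [] := fP _ (zbad n).
have zn n : (z n).1.1 = n by elim: n => // n IH; have [-> _ _] := zs n; rewrite IH.
pose j n := (z n).1.2; pose b n := (z n).2.
have jn n : (j n < 2 ^ n)%N by have [] := zbad n; rewrite zn.
have bS n : agree n (b n.+1) (b n) by have [_ _] := zs n; rewrite zn.
have bD n m : agree n (b (n + m)%N) (b n).
  elim: m => [|m IH] k kn; first by rewrite addn0.
  by rewrite addnS bS ?IH//; lia.
(* Digit [k] is frozen from generation k + 1 on, so this diagonal sequence agrees with every box. *)
pose c k := b k.+1 k.
have cb n : agree n c (b n).
  move=> k kn; rewrite /c (_ : n = k.+1 + (n - k.+1))%N; last lia.
  by rewrite bD.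
have jD n m : dy n (j n) <= dy (n + m) (j (n + m)%N) /\
    dy (n + m) (j (n + m)%N).+1 <= dy n (j n).+1.
  elim: m => [|m [IH1 IH2]]; first by rewrite addn0.
  rewrite addnS; set l := (n + m)%N in IH1 IH2 *.
  have [_ jj _] := zs l.
  rewrite -(dy_double l (j l)) in IH1.
  rewrite -(dy_double l (j l).+1) doubleS in IH2.
  have : dy l.+1 (j l).*2 <= dy l.+1 (j l.+1).
    by rewrite dy_le /j; case: jj => ->.
  have : dy l.+1 (j l.+1).+1 <= dy l.+1 (j l).*2.+2.
    by rewrite dy_le /j; case: jj => ->.
  by lra.
have jlr n m : dy n (j n) <= dy m (j m).+1.
  have [|] := leqP n m => nm.
    have := jD n (m - n)%N; rewrite subnKC// => -[+ _].
    have : dy m (j m) <= dy m (j m).+1 by rewrite dy_le.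
    lra.
  have := jD m (n - m)%N; rewrite subnKC ?(ltnW nm)// => -[_].
  have : dy n (j n) <= dy n (j n).+1 by rewrite dy_le.
  lra.
pose t := sup (range (fun n => dy n (j n))).
have tj n : dy n (j n) <= t <= dy n (j n).+1.
  apply/andP; split.
    apply: ub_le_sup; last by exists n.
    by exists (dy 0 (j 0%N).+1) => _ [m _ <-].
  apply: ge_sup; first by exists (dy 0 (j 0%N)), 0%N.
  by move=> _ [m _ <-].
have [i _ Ui] := cU (lpt t c) Logic.I.
have [e e0 eU] := oU i _ Ui.
have [n ne] := exp2_small e0.
have [_] := zbad n; rewrite zn; apply; exists [set i]; first exact: finite_set1.
move=> y yb; exists i => //; apply: eU; rewrite /mball /=.
apply: le_lt_trans ne; apply: dbox_ldist (jn n) _ yb.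
by apply: lpt_dbox.
Qed.

(** * Balls compared with boxes *)

Definition lo (x : @laakso R) r : R := Num.max 0 (ht x - r).
Definition hi (x : @laakso R) r : R := Num.min 1 (ht x + r).

Lemma lohi (x : laakso) r : 0 < r ->
  [/\ 0 <= lo x r, lo x r < hi x r, hi x r <= 1 &
      [/\ lo x r <= ht x <= hi x r, hi x r - lo x r <= 2 * r &
       (r <= hi x r - lo x r) \/ (lo x r = 0 /\ hi x r = 1)]].
Proof.
move=> r0; have := ht01 x; rewrite /lo /hi.
by case: (leP 0 (ht x - r)) => ?; case: (leP 1 (ht x + r)) => ?;
  do ?split; try lra; (left; lra) || (right; lra).
Qed.

Lemma lohi_double (x : laakso) r : 0 < r ->
  [/\ lo x (2 * r) <= lo x r, hi x r <= hi x (2 * r) &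
      hi x (2 * r) - lo x (2 * r) <= 2 * (hi x r - lo x r)].
Proof.
move=> r0; have := ht01 x; rewrite /lo /hi.
by case: (leP 0 (ht x - r)) => ?; case: (leP 1 (ht x + r)) => ?;
  case: (leP 0 (ht x - 2 * r)) => ?; case: (leP 1 (ht x + 2 * r)) => ?;
  split; lra.
Qed.

Definition fiber (x : laakso) r : set (nat -> bool) :=
  [set b | forall k, ~ hit k (lo x r) (hi x r) -> b k = dg x k].

(** A path shorter than [r] stays at heights within [r] of [ht x], so it cannot change the digit of
    a level without a worm hole there. *)
Lemma ball_fiber (x : laakso) r t b : 0 <= t <= 1 -> ldist x (lpt t b) < r ->
  lo x r <= t <= hi x r /\ fiber x r b.
Proof.
move=> t01; rewrite -{1}(lpt_surj x).
have [p [q [[p0 [ps pt] [sq tq] q1 L] ->]]] :=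
  ldist_lptP (dg x) b (ht01 x) t01 => d.
have lp : lo x r <= p.
  by rewrite /lo ge_max; move: d; case: (lerP (ht x) t) => ? ?; lra.
have qh : q <= hi x r.
  by rewrite /hi le_min; move: d; case: (lerP (ht x) t) => ? ?; lra.
split; first lra.
move=> k nh; apply/eqP; rewrite eq_sym; apply: contraT => /L H.
by exfalso; apply: nh; apply: hit_sub H.
Qed.

(** The whole interval is feasible and has length at most 2r, so the cost is at most 4r; the factor
    5 makes the inequality strict. *)
Lemma fiber_ball (x : laakso) r t b : 0 < r -> lo x r <= t <= hi x r ->
  fiber x r b -> ldist x (lpt t b) < 5 * r.
Proof.
move=> r0 tx fb; have [l0 lh h1 [xl d2 _]] := lohi x r0.
have t01 : 0 <= t <= 1 by lra.
have F : feasible (ht x) (dg x) t b (lo x r) (hi x r).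
  split; try lra; move=> k; apply: contraNP => /fb ->; exact: eqxx.
have := ldist_lpt_le (ht01 x) t01 F; rewrite lpt_surj.
by have := normr_ge0 (ht x - t); lra.
Qed.

(** Hence [fiber] constrains finitely many digits only, which makes it measurable with an explicit
    mass. *)
Lemma hit_large (x : laakso) r : 0 < r -> exists N, forall k, (N <= k)%N ->
  hit k (lo x r) (hi x r).
Proof.
move=> r0; have [l0 lh h1 _] := lohi x r0.
have [|N HN] := @exp2_small (hi x r - lo x r); first lra.
exists N => k Nk; apply: hit_long => //.
have : 2 / 2 ^+ k <= 2 / 2 ^+ N :> R.
  by rewrite ler_pM2l// lef_pV2 ?posrE ?exprn_gt0// ler_eXn2l// ltr1n.
lra.
Qed.

(* The levels that become free when the radius doubles: the least one [k1],
   and those within 3 of the second least one [k2], because two worm holes of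
   distinct levels at most [k2] are [2^-(k2+1)]-separated. *)
Lemma new_levels (x : laakso) r : 0 < r -> exists2 s : seq nat, (size s <= 5)%N &
  forall k, hit k (lo x (2 * r)) (hi x (2 * r)) ->
    ~ hit k (lo x r) (hi x r) -> k \in s.
Proof.
move=> r0; pose E k := hit k (lo x (2 * r)) (hi x (2 * r)) /\
  ~ hit k (lo x r) (hi x r).
(* An interval of length at least [r] that misses level [k] is too short for [hit_long]. *)
have Er k : E k -> r < 2 / 2 ^+ k.
  move=> [_ nh]; have [l0 lh h1 [_ _ [H|[L H]]]] := lohi x r0; last first.
    by exfalso; apply: nh; rewrite L H; exact: hit01.
  rewrite ltNge; apply/negP => H'; apply: nh; apply: hit_long => //; lra.
have Ek k k' K : (k < k')%N -> E k -> E k' -> E K -> (K <= k' + 3)%N.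
  move=> kk' [[z wz zx] _] [[z' wz' zx'] _] /Er HK.
  have sep := worm_sep kk' wz wz'.
  have r20 : 0 < 2 * r by lra.
  have [_ _ _ [_ d2 _]] := lohi x r20.
  have : `|z - z'| <= 4 * r by rewrite ler_norml; lra.
  have [//|] := leqP K (k' + 3) => kK.
  (* If K > k' + 3, the separation of the two worm holes is at least 8 / 2^K, which exceeds 4r by
     [Er]; but both lie in an interval of length at most 4r. *)
  have : 8 / 2 ^+ K <= 1 / 2 ^+ k'.+1 :> R.
    rewrite ler_pdivrMr ?exprn_gt0// mulrAC mul1r ler_pdivlMr ?exprn_gt0//.
    rewrite (_ : 8 = 2 ^+ 3 :> R); last by rewrite -natrX.
    by rewrite -exprD ler_eXn2l ?ltr1n//; lia.
  lra.
have [[k1 Ek1]|/forallNP nE] := pselect (exists k, E k); last first.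
  by exists [::] => // k H1 H2; case: (nE k).
have ex1 : exists k, `[< E k >] by exists k1; apply/asboolP.
case: (ex_minnP ex1) => {Ek1}k1 /asboolP Ek1 min1.
have [[k2 [Ek2 lt2]]|/forallNP nE] := pselect (exists k, E k /\ (k1 < k)%N); last first.
  exists [:: k1] => // k H1 H2; rewrite inE; apply/eqP.
  have := min1 k; rewrite asboolT// => /(_ isT).
  by rewrite leq_eqVlt => /orP[/eqP//|k1k]; case: (nE k).
have ex2 : exists k, `[< E k >] && (k1 < k)%N.
  by exists k2; rewrite lt2 andbT; apply/asboolP.
case: (ex_minnP ex2) => {Ek2 lt2}k2 /andP[/asboolP Ek2 lt2] min2.
exists [:: k1; k2; k2.+1; k2.+2; k2.+3] => // k H1 H2.
have Hk : E k by [].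
have := min1 k; rewrite asboolT// => /(_ isT).
have := Ek _ _ _ lt2 Ek1 Ek2 Hk.
have := min2 k; rewrite (asboolT Hk) /= !inE.
have [k1k|kk1] := ltnP k1 k; first by move=> /(_ isT) A B C; lia.
by move=> _ _ C; rewrite (_ : k = k1) ?eqxx//; lia.
Qed.

(** * Arc length and upper gradients along mixed paths *)

Lemma isometry_arclength (X : Type) (dist : X -> X -> R) (g : R -> X) (L : R) :
  (forall s t, 0 <= s -> s <= t -> t <= L -> dist (g s) (g t) = t - s) ->
  arclength_param dist g L.
Proof.
move=> iso s t s0 st tL.
rewrite /curve_length (_ : [set _ | _ in _] = [set (t - s)%:E]).
  by rewrite ereal_sup1.
(* All partition sums telescope to the same value, so the supremum runs over a singleton. *)
have sumE (q : seq R) u : 0 <= u -> sorted <=%R (u :: q) -> last u q <= L ->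
    \sum_(i < size q) dist (g (nth s (u :: q) i)) (g (nth s q i)) = last u q - u.
  elim: q u => [|v q IH] u u0 /= pq lL; first by rewrite big_ord0 subrr.
  move: pq => /andP[uv pq].
  have v0 : 0 <= v by lra.
  have vlast : v <= last v q.
    by move: pq; rewrite (path_sortedE le_trans) => /andP[/allP + _];
      case: (q) => //= w q' /(_ _ (mem_last _ _)).
  rewrite big_ord_recl /= iso//; last lra.
  by rewrite (IH v)//; ring.
apply/seteqP; split=> [_ [q [sq lq] <-]|_ ->] /=.
  by congr EFin; rewrite -[in RHS]lq; apply: sumE => //; rewrite lq.
exists [:: t]; first by rewrite /= st.
by rewrite big_ord_recl big_ord0 /= addr0 iso.
Qed.

(** Height parametrizes the mixed path isometrically, hence by arc length. It does start at
    [lpt p a]: a digit switched at height [p] itself is identified there. *)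
Lemma upper_gradient_mix (u : laakso -> R) (rho : laakso -> \bar R) p q a b :
  upper_gradient (@ldist R) u rho -> 0 <= p -> p <= q -> q <= 1 ->
  (`|u (lpt p a) - u (lpt q (mix p a b q))|%:E <=
   line_integral (fun t => lpt (p + t) (mix p a b (p + t))) (q - p) rho)%E.
Proof.
move=> ug p0 pq q1.
set g := fun t => lpt (p + t) (mix p a b (p + t)).
have -> : lpt p a = g 0 by rewrite /g addr0 lpt_mix_start//; lra.
have -> : lpt q (mix p a b q) = g (q - p) by rewrite /g addrC subrK.
apply: ug; first lra.
apply: isometry_arclength => s t s0 st tL.
by rewrite /g lpt_mix_dist; lra.
Qed.

End Dyadic.

(** * Bernoulli measures on the Cantor space *)

Definition cyl n (b : nat -> bool) : set (nat -> bool) := [set a | agree n a b].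

(** The empty set is added to obtain a pi-system: two cylinders are either nested or disjoint. *)
Definition cylinders : set (set (nat -> bool)) :=
  [set C | C = set0 \/ exists n b, C = cyl n b].

Definition cantor := g_sigma_algebraType cylinders.
HB.instance Definition _ := Measurable.on cantor.

Lemma cylI : setI_closed cylinders.
Proof.
move=> _ _ [->|[n [b ->]]] [->|[m [c ->]]]; rewrite ?set0I ?setI0; try by left.
wlog nm : n m b c / (n <= m)%N.
  by move=> W; have [/W//|/ltnW/W] := leqP n m; rewrite setIC; apply.
have [[a [ab ac]]|] := pselect (exists a, agree n a b /\ agree m a c).
  right; exists m, c; apply/seteqP; split=> [x []//|x xc]; split=> // k kn.
  by rewrite xc ?(leq_trans kn)// -ac ?(leq_trans kn)// ab.
by move=> H; left; apply/seteqP; split=> // x [xb xc]; case: H; exists x.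
Qed.

Lemma measurable_cyl n b : measurable (cyl n b : set cantor).
Proof. by apply: sub_sigma_algebra; right; exists n, b. Qed.

Lemma measurable_digit k e : measurable ([set b : cantor | b k = e] : set cantor).
Proof.
(* Finite words, prolonged by [false], serve as a countable index set for the cylinders. *)
rewrite (_ : mkset _ = \bigcup_(v in [set: seq bool])
    (if nth false v k == e then cyl k.+1 (nth false v) else set0)).
  apply: countable_bigcupT_measurable => [|v]; first exact: countableP.
  by case: ifP => _; [exact: measurable_cyl|exact: measurable0].
apply/seteqP; split=> [b /= bk|b [v _]].
  exists (mkseq b k.+1) => //; rewrite nth_mkseq// bk eqxx => i ik.
  by rewrite nth_mkseq.
by case: ifP => // /eqP <- bv /=; rewrite bv.
Qed.

Lemma measurable_digits d (T : measurableType d) (f : T -> cantor) :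
  (forall k e, measurable [set x | f x k = e]) -> measurable_fun setT f.
Proof.
move=> mf; apply: (@measurability _ _ T cantor setT f cylinders erefl).
move=> _ [C [->|[n [b ->]]] <-]; rewrite setTI ?preimage_set0//.
rewrite (_ : _ @^-1` _ = \bigcap_(k in `I_n) [set x | f x k = b k])//.
by apply: bigcap_measurableType => k _; exact: mf.
Qed.

Lemma measurable_fun_digit d (T : measurableType d) (f : T -> cantor) k e :
  measurable_fun setT f -> measurable [set x | f x k = e].
Proof.
by move=> /(_ measurableT _ (measurable_digit k e)); rewrite setTI.
Qed.

Lemma measurable_constraint (n : nat) (S : nat -> bool -> bool) :
  measurable ([set b : cantor | forall k, (k < n)%N -> S k (b k)] : set cantor).
Proof.
rewrite (_ : mkset _ = \bigcap_(k in `I_n)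
    ((if S k true then [set b | b k = true] else set0) `|`
     (if S k false then [set b | b k = false] else set0))).
  apply: bigcap_measurableType => k _.
  by apply: measurableU; case: ifP => // _; exact: measurable_digit.
apply/seteqP; split=> b Sb k /= kn.
  by have := Sb k kn; case E : (b k) => ->; [left|right].
have := Sb k kn; case E : (b k) => -[].
- by case: ifP.
- by case: ifP => //= _; rewrite E.
- by case: ifP => //= _; rewrite E.
- by case: ifP.
Qed.

Section Bernoulli.
Context {R : realType}.
Local Notation leb := (@lebesgue_measure R).
Implicit Types (w l p x : R).

Definition unit_measure : set (measurableTypeR R) -> \bar R :=
  mrestr leb (measurable_itv `[(0:R), 1]).

HB.instance Definition _ := Measure.on unit_measure.

Lemma unit_measure_setT : unit_measure setT = 1%E.
Proof.
by rewrite /unit_measure /mrestr setTI lebesgue_measure_itv /= lte_fin ltr01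
  oppr0 adde0.
Qed.

HB.instance Definition _ :=
  @Measure_isProbability.Build _ _ R unit_measure unit_measure_setT.

(* The digits of [x] in the subdivision of [l, l + p[ where each interval is
   cut in proportion w : 1 - w, the left part carrying the digit [true]. *)
Fixpoint digits w l p x (k : nat) : bool :=
  let e := x < l + p * w in
  if k is k'.+1 then
    if e then digits w l (p * w) x k'
    else digits w (l + p * w) (p * (1 - w)) x k'
  else e.

Lemma measurable_set_digits w l p k e :
  measurable ([set x | digits w l p x k = e] : set (measurableTypeR R)).
Proof.
have mlt c : measurable ([set x | (x < c) = true] : set (measurableTypeR R)).
  rewrite (_ : mkset _ = `]-oo, c[%classic); first exact: measurable_itv.
  by apply/seteqP; split=> x /=; rewrite in_itv.
have mge c : measurable ([set x | (x < c) = false] : set (measurableTypeR R)).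
  rewrite (_ : mkset _ = ~` [set x | (x < c) = true]); first exact: measurableC.
  by apply/seteqP; split=> x /=; case: (x < c).
elim: k l p => [|k IH] l p /=; first by case: e.
rewrite (_ : mkset _ =
  ([set x | (x < l + p * w) = true] `&` [set x | digits w l (p * w) x k = e])
  `|` ([set x | (x < l + p * w) = false] `&`
       [set x | digits w (l + p * w) (p * (1 - w)) x k = e])).
  by apply: measurableU; apply: measurableI.
apply/seteqP; split=> x /=; case: ifP => ?; [by left|by right| |].
- by case=> -[].
- by case=> -[].
Qed.

Definition digits01 w : measurableTypeR R -> cantor := digits w 0 1.

Lemma measurable_digits01 w : measurable_fun setT (digits01 w).
Proof. by apply: measurable_digits => k e; exact: measurable_set_digits. Qed.

HB.instance Definition _ w := isMeasurableFun.Build _ _ _ _ (digits01 w)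
  (measurable_digits01 w).

Definition wt w (e : bool) : R := if e then w else 1 - w.

(** Induction on [n]: the first digit cuts [l, l + p[ at l + pw, and on each piece the remaining
    digits are those of the same construction, with [S] shifted. Hence the generality in [l], [p]
    and [S]. *)
Lemma digits_law w l p n (S : nat -> bool -> bool) : 0 < w < 1 -> 0 <= p ->
  leb [set x | l <= x < l + p /\ forall k, (k < n)%N -> S k (digits w l p x k)] =
  (p * \prod_(k < n) (wt w true *+ S k true + wt w false *+ S k false))%:E.
Proof.
move=> w01; elim: n l p S => [|n IH] l p S p0.
  rewrite big_ord0 mulr1 (_ : mkset _ = `[l, l + p[%classic).
    rewrite lebesgue_measure_itv /= lte_fin; case: ltP => lp.
      by rewrite -EFinD; congr EFin; lra.
    by congr EFin; lra.
  by apply/seteqP; split=> x /=; rewrite in_itv /=; [case|split].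
have mA l' p' (S' : nat -> bool -> bool) :
    measurable ([set x | l' <= x < l' + p' /\
      forall k, (k < n)%N -> S' k (digits w l' p' x k)] : set (measurableTypeR R)).
  rewrite (_ : mkset _ = `[l', l' + p'[%classic `&`
      digits w l' p' @^-1` [set b | forall k, (k < n)%N -> S' k (b k)]).
    apply: measurableI; first exact: measurable_itv.
    have mf : measurable_fun setT (digits w l' p' : measurableTypeR R -> cantor).
      by apply: measurable_digits => k e; exact: measurable_set_digits.
    by have := mf measurableT _ (measurable_constraint n S'); rewrite setTI.
  by apply/seteqP; split=> x /=; rewrite in_itv.
rewrite big_ord_recl /=.
rewrite (_ : mkset _ =
  (if S 0%N true then [set x | l <= x < l + p * w /\
     forall k, (k < n)%N -> S k.+1 (digits w l (p * w) x k)] else set0) `|`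
  (if S 0%N false then [set x | l + p * w <= x < l + p * w + p * (1 - w) /\
     forall k, (k < n)%N ->
       S k.+1 (digits w (l + p * w) (p * (1 - w)) x k)] else set0)); last first.
  apply/seteqP; split=> x /=.
    move=> [/andP[lx xp] Sx]; have := Sx 0%N isT; rewrite /=.
    case: ltP => c S0; [left|right]; rewrite S0 /=.
      rewrite lx c; split=> // k kn; have := Sx k.+1 kn.
      by rewrite /= c.
    rewrite c /=; split; first lra.
    by move=> k kn; have := Sx k.+1 kn; rewrite /= ltNge c.
  case; case: ifP => // S0 /= [/andP[lx xp] Sx].
    have pw : 0 <= p * (1 - w) by apply: mulr_ge0; lra.
    split; first lra.
    by move=> [|k] kn /=; rewrite xp//; exact: Sx.
  have pw : 0 <= p * w by apply: mulr_ge0; lra.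
  split; first lra.
  by move=> [|k] kn /=; rewrite ltNge lx//=; exact: Sx.
have pw1 : 0 <= p * w by apply: mulr_ge0; lra.
have pw2 : 0 <= p * (1 - w) by apply: mulr_ge0; lra.
rewrite measureU; last 3 first.
- by case: ifP => // _; exact: (mA _ _ (fun k => S k.+1)).
- by case: ifP => // _; exact: (mA _ _ (fun k => S k.+1)).
- apply/seteqP; split=> // x; case: ifP => _ [] //; case: ifP => _ //=.
  by move=> [/andP[_ ?] _] [/andP[? _] _]; lra.
have E1 := IH l (p * w) (fun k => S k.+1) pw1.
have E2 := IH (l + p * w) (p * (1 - w)) (fun k => S k.+1) pw2.
case: (S 0%N true); case: (S 0%N false); rewrite /= ?measure0;
  rewrite ?[leb [set x | l <= x < l + p * w /\ _]]E1
    ?[leb [set x | l + p * w <= x < _ /\ _]]E2 -?EFinD ?adde0 ?add0e;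
  congr EFin; rewrite /wt ?mulr1n ?mulr0n; ring.
Qed.

(** The uniform law on [0, 1] is pushed forward by [digits01]; later arguments see [bern] only
    through this law. *)
Lemma bern_spec w : {nu : probability cantor R | 0 < w < 1 ->
  forall n (S : nat -> bool -> bool),
  nu [set b | forall k, (k < n)%N -> S k (b k)] =
  (\prod_(k < n) (wt w true *+ S k true + wt w false *+ S k false))%:E}.
Proof.
exists (distribution unit_measure (digits01 w)) => w01 n S.
rewrite -[X in X%:E]mul1r -(@digits_law w 0 1)//.
set A := [set b | _].
have mA : measurable (A : set cantor) by exact: measurable_constraint.
rewrite /distribution /pushforward /= /unit_measure /mrestr.
have mB : measurable (digits01 w @^-1` A).
  by rewrite -[X in measurable X]setTI; exact: measurable_digits01.
(* [digits_law] concerns the half-open interval, so the null point 1 is split off. *)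
rewrite (_ : `[(0:R), 1]%classic = `[0, 1[%classic `|` [set 1]); last first.
  by rewrite setUitv1//= bnd_simp.
rewrite setIUr measureU//=.
- rewrite [X in (_ + X)%E](_ : _ = 0%E) ?adde0.
    congr leb; apply/seteqP; split=> x /=; rewrite in_itv /= add0r.
      by move=> [].
    by move=> [].
  have mI : measurable (digits01 w @^-1` A `&` [set 1]) by exact: measurableI.
  apply/eqP; rewrite eq_le measure_ge0 andbT -(lebesgue_measure_set1 1).
  by apply: le_measure; rewrite ?inE//; exact: subIsetr.
- by apply: measurableI => //; exact: measurable_itv.
- exact: measurableI.
- apply/seteqP; split=> // x /= [[_]]; rewrite in_itv /= => /andP[_ x1] [_ E].
  by move: x1; rewrite E ltxx.
Qed.

Definition bern w : probability cantor R := sval (bern_spec w).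

Lemma bern_law w n (S : nat -> bool -> bool) : 0 < w < 1 ->
  bern w [set b | forall k, (k < n)%N -> S k (b k)] =
  (\prod_(k < n) (wt w true *+ S k true + wt w false *+ S k false))%:E.
Proof. by move=> w01; exact: (svalP (bern_spec w)). Qed.

Lemma bern_cyl w n b : 0 < w < 1 ->
  bern w (cyl n b) = (\prod_(k < n) wt w (b k))%:E.
Proof.
move=> w01; rewrite (_ : cyl n b =
    [set a | forall k, (k < n)%N -> a k == b k]); last first.
  by apply/seteqP; split=> a /= ab k kn; apply/eqP/ab.
rewrite (@bern_law w n (fun k e => e == b k))//; congr EFin.
apply: eq_bigr => k _.
by case: (b k) => /=; rewrite ?addr0 ?add0r.
Qed.

End Bernoulli.

(** * Mixing and mutual singularity of Bernoulli measures *)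

(** At a fixed height [mix] has this form, with [F] the set of levels already met. *)
Definition select (F : nat -> bool) (z : cantor * cantor) : cantor :=
  fun k => if F k then z.2 k else z.1 k.

Lemma measurable_select F : measurable_fun setT (select F).
Proof.
apply: measurable_digits => k e; rewrite /select.
by case: (F k); apply: measurable_fun_digit;
  [exact: measurable_snd|exact: measurable_fst].
Qed.

HB.instance Definition _ F := isMeasurableFun.Build _ _ _ _ (select F)
  (measurable_select F).

Section BernoulliMixing.
Context {R : realType}.
Implicit Types (w : R).

Lemma wt_gt0 w e : 0 < w < 1 -> 0 < wt w e.
Proof. by rewrite /wt; case: e; lra. Qed.

Lemma wt_eq w (e : bool) (G : bool) :
  wt w true *+ (G ==> (true == e)) + wt w false *+ (G ==> (false == e)) =
  if G then wt w e else 1.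
Proof. by case: G; case: e; rewrite /= /wt ?mulr1n ?mulr0n; ring. Qed.

Lemma bern_partial w n (G c : nat -> bool) : 0 < w < 1 ->
  bern w [set b | forall k, (k < n)%N -> G k -> b k = c k] =
  (\prod_(k < n) (if G k then wt w (c k) else 1))%:E.
Proof.
move=> w01; rewrite (_ : mkset _ =
    [set b | forall k, (k < n)%N -> G k ==> (b k == c k)]).
  rewrite (@bern_law _ w n (fun k e => G k ==> (e == c k)))//; congr EFin.
  by apply: eq_bigr => k _; rewrite wt_eq.
apply/seteqP; split=> b /= H k kn; first by apply/implyP => Gk; apply/eqP/H.
by move=> Gk; have /implyP/(_ Gk)/eqP := H k kn.
Qed.

Lemma measurable_partial n (G c : nat -> bool) :
  measurable ([set b | forall k, (k < n)%N -> G k -> b k = c k] : set cantor).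
Proof.
rewrite (_ : mkset _ =
    [set b | forall k, (k < n)%N -> (fun k e => G k ==> (e == c k)) k (b k)]).
  exact: (measurable_constraint n (fun k e => G k ==> (e == c k))).
apply/seteqP; split=> b /= H k kn; first by apply/implyP => Gk; apply/eqP/H.
by move=> Gk; have /implyP/(_ Gk)/eqP := H k kn.
Qed.

(** By uniqueness on the pi-system it suffices to test cylinders. The preimage of a cylinder is a
    product of constraints on the levels outside and inside [F], whose weights recombine to the full
    product. *)
Lemma bern_select w F A : 0 < w < 1 -> measurable A ->
  (bern w \x bern w)%E (select F @^-1` A) = bern w A.
Proof.
move=> w01 mA.
suff : distribution (bern w \x bern w)%E (select F) A = bern w A by [].
apply: (@measure_unique _ R cantor cylinders (fun=> setT)) mA => //.
- exact: cylI.
- move=> _; right; exists 0%N, (fun=> false).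
  by apply/seteqP; split=> // b _ k; rewrite ltn0.
- by rewrite bigcup_const//; exists 0%N.
- move=> _ [->|[n [c ->]]]; first by rewrite !measure0.
  transitivity (\prod_(k < n) wt w (c k))%:E; last exact/esym/bern_cyl.
  rewrite /= /distribution /pushforward.
  rewrite (_ : select F @^-1` _ =
      [set b | forall k, (k < n)%N -> ~~ F k -> b k = c k] `*`
      [set b | forall k, (k < n)%N -> F k -> b k = c k]); last first.
    apply/seteqP; split=> -[a b] /=; rewrite /select.
      move=> H; split=> k kn Fk; have := H k kn; rewrite /= ?Fk//.
      by rewrite (negbTE Fk).
    by move=> [H1 H2] k kn /=; case: ifP => Fk; [exact: H2|apply: H1; rewrite ?Fk].
  transitivity
    (bern w [set b | forall k, (k < n)%N -> ~~ F k -> b k = c k] *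
     bern w [set b | forall k, (k < n)%N -> F k -> b k = c k])%E.
    apply: product_measure1E; last exact: measurable_partial.
    exact: (measurable_partial n (fun k => ~~ F k)).
  rewrite (bern_partial n (fun k => ~~ F k))// bern_partial// -EFinM.
  rewrite -big_split /=; congr EFin; apply: eq_bigr => k _.
  by case: (F k); rewrite /= ?mulr1 ?mul1r.
- by move=> _; rewrite (le_lt_trans (probability_le1 _ _))// ltry.
Qed.

(** Each additional constraint in [G2] multiplies the mass by at least min(w, 1 - w), and all of
    them occur in [s]. *)
Lemma partial_compare w n (G1 G2 c : nat -> bool) (s : seq nat) : 0 < w < 1 ->
  (forall k, G1 k -> G2 k) -> (forall k, G2 k -> ~~ G1 k -> k \in s) ->
  Num.min w (1 - w) ^+ size s * \prod_(k < n) (if G1 k then wt w (c k) else 1) <=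
  \prod_(k < n) (if G2 k then wt w (c k) else 1).
Proof.
set th := Num.min w (1 - w) => w01 G12 G21s.
have th0 : 0 < th by rewrite lt_min; lra.
have th1 : th <= 1 by rewrite ge_min; lra.
have thwt k : th <= wt w (c k).
  by rewrite /wt; case: (c k); rewrite ge_min lexx ?orbT.
(* Since [th] is at most 1, repetitions in [s] and entries beyond [n] only make the left side
   smaller. *)
have H : th ^+ size s <= \prod_(k < n) (if (k : nat) \in s then th else 1).
  rewrite -big_mkcond /= prodr_const; apply: ler_wiXn2l => //; first exact: ltW.
  rewrite cardE -(size_map val); apply: uniq_leq_size.
    by rewrite map_inj_uniq ?enum_uniq//; exact: val_inj.
  by move=> _ /mapP[k + ->]; rewrite mem_enum.
have P0 : 0 <= \prod_(k < n) (if G1 k then wt w (c k) else 1).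
  by apply: prodr_ge0 => k _; case: ifP => // _; exact/ltW/wt_gt0.
apply: le_trans (ler_wpM2r P0 H) _; rewrite -big_split /=.
apply: ler_prod => k _; have := thwt k; have := wt_gt0 (c k) w01.
case G1k : (G1 k); case G2k : (G2 k); case: ifPn => ks; rewrite ?mulr1 ?mul1r;
  move=> ? ?; apply/andP; split; try lra.
- by rewrite mulr_ge0; lra.
- by rewrite ger_pMl.
- by rewrite (G12 _ G1k) in G2k.
- by rewrite (G12 _ G1k) in G2k.
- by rewrite (G12 _ G1k) in G2k.
- by move: ks; rewrite (G21s _ G2k) ?G1k.
Qed.

(** * Hellinger affinity and mutual singularity *)

Definition hell w w' : R := Num.sqrt (w * w') + Num.sqrt ((1 - w) * (1 - w')).

Lemma sqrt_amgm (x y : R) : 0 < x -> 0 < y -> x != y ->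
  Num.sqrt (x * y) < (x + y) / 2.
Proof.
move=> x0 y0 xy; rewrite -(@ger0_norm _ ((x + y) / 2)); last lra.
rewrite -sqrtr_sqr ltr_sqrt; last by rewrite exprn_gt0//; lra.
have : 0 < (x - y) ^+ 2 by rewrite exprn_even_gt0//= subr_eq0.
by rewrite !expr2; nra.
Qed.

(** Strict AM-GM on both terms; the two arithmetic means add up to 1. *)
Lemma hell_lt1 w w' : 0 < w < 1 -> 0 < w' < 1 -> w != w' -> hell w w' < 1.
Proof.
move=> w01 w'01 ww'; rewrite /hell.
have := @sqrt_amgm w w'; have := @sqrt_amgm (1 - w) (1 - w').
have -> : 1 - w != 1 - w' by apply: contra_neq ww' => ?; lra.
by rewrite ww' => H1 H2; have := H1 ltac:(lra) ltac:(lra) isT;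
  have := H2 ltac:(lra) ltac:(lra) isT; lra.
Qed.

Lemma hell_ge0 w w' : 0 <= hell w w'.
Proof. by rewrite /hell addr_ge0 ?sqrtr_ge0. Qed.

(** A likelihood test on the first [n] digits: improbable under [w], and its complement lies in the
    same test with [w] and [w'] exchanged. *)
Definition less_likely w w' n : set cantor :=
  [set b | \prod_(k < n) wt w (b k) <= \prod_(k < n) wt w' (b k)].

Lemma less_likelyE w w' n : less_likely w w' n =
  \big[setU/set0]_(f : {ffun 'I_n -> bool} |
      \prod_(k < n) wt w (f k) <= \prod_(k < n) wt w' (f k))
    cyl n (fun k => oapp f false (insub k)).
Proof.
have fE (f : {ffun 'I_n -> bool}) (k : 'I_n) : oapp f false (insub (val k)) = f k.
  by rewrite valK.
rewrite -bigcup_seq_cond; apply/seteqP; split=> b /=.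
  rewrite /less_likely /= => H; exists [ffun k : 'I_n => b k].
    rewrite /= mem_index_enum /=.
    by under eq_bigr do rewrite ffunE; under [leRHS]eq_bigr do rewrite ffunE.
  by move=> k kn; rewrite -[k]/(val (Ordinal kn)) fE ffunE.
move=> [f /= /andP[_ H] bf]; rewrite /less_likely /=.
under eq_bigr => k _ do rewrite (bf k (ltn_ord k)) fE.
by under [leRHS]eq_bigr => k _ do rewrite (bf k (ltn_ord k)) fE.
Qed.

Lemma measurable_less_likely w w' n : measurable (less_likely w w' n).
Proof.
by rewrite less_likelyE; apply: bigsetU_measurable => f _; exact: measurable_cyl.
Qed.

Lemma measure_bigsetU_le d (T : measurableType d) (mu : {measure set T -> \bar R})
    (I : Type) (s : seq I) (P : pred I) (F : I -> set T) :
  (forall i, measurable (F i)) ->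
  (mu (\big[setU/set0]_(i <- s | P i) F i) <= \sum_(i <- s | P i) mu (F i))%E.
Proof.
move=> mF; elim: s => [|i s IH]; first by rewrite !big_nil measure0.
rewrite !big_cons; case: ifP => // _.
apply: le_trans (measureU2 mu _ _) _ => //; first exact: bigsetU_measurable.
by rewrite leeD2l.
Qed.

(** On this event the [w]-weight of a word is at most the geometric mean of its two weights. Summed
    over all words, the geometric means factor digit by digit into the n-th power of the
    affinity. *)
Lemma bern_less_likely w w' n : 0 < w < 1 -> 0 < w' < 1 ->
  (bern w (less_likely w w' n) <= (hell w w' ^+ n)%:E)%E.
Proof.
move=> w01 w'01; rewrite less_likelyE.
apply: le_trans (measure_bigsetU_le _ _ _ _) _.
  by move=> f; exact: measurable_cyl.
pose r e := Num.sqrt (wt w e * wt w' e).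
have -> : hell w w' ^+ n = \sum_(f : {ffun 'I_n -> bool}) \prod_k r (f k).
  rewrite -(bigA_distr_bigA (fun (_ : 'I_n) e => r e)) prodr_const card_ord.
  by rewrite big_bool.
rewrite (eq_bigr (fun f : {ffun 'I_n -> bool} =>
    (\prod_(k < n) wt w (oapp f false (insub (k : nat))))%:E)); last first.
  by move=> f _; exact: bern_cyl.
rewrite sumEFin lee_fin.
apply: le_trans (_ : \sum_(f : {ffun 'I_n -> bool} |
   \prod_(k < n) wt w (f k) <= \prod_(k < n) wt w' (f k)) \prod_k r (f k) <= _);
   last first.
  rewrite [leRHS](bigID (fun f : {ffun 'I_n -> bool} =>
    \prod_(k < n) wt w (f k) <= \prod_(k < n) wt w' (f k))) /=.
  by rewrite lerDl; apply: sumr_ge0 => f _; apply: prodr_ge0 => k _; exact: sqrtr_ge0.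
apply: ler_sum => f H.
rewrite (eq_bigr (fun k : 'I_n => wt w (f k))); last by move=> k _; rewrite valK.
have p0 (v : R) : 0 < v < 1 -> 0 <= \prod_(k < n) wt v (f k).
  by move=> v01; apply: prodr_ge0 => k _; apply: ltW; exact: wt_gt0.
rewrite -(@ler_pXn2r _ 2)// ?nnegrE ?p0//; last first.
  by apply: prodr_ge0 => k _; exact: sqrtr_ge0.
rewrite -[leRHS]prodrXl.
have -> : \prod_(k < n) r (f k) ^+ 2 =
    \prod_(k < n) wt w (f k) * \prod_(k < n) wt w' (f k).
  rewrite -big_split /=; apply: eq_bigr => k _; rewrite sqr_sqrtr//.
  by rewrite mulr_ge0// ltW// wt_gt0.
by rewrite expr2; apply: ler_wpM2l; rewrite ?p0.
Qed.

Lemma geometric_borel_cantelli d (T : measurableType d)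
    (mu : {measure set T -> \bar R}) (F : (set T)^nat) (r : R) :
  0 <= r < 1 -> (forall n, measurable (F n)) ->
  (forall n, (mu (F n) <= (r ^+ n)%:E)%E) -> mu (lim_sup_set F) = 0%E.
Proof.
move=> /andP[r0 r1] mF Fr; apply: lim_sup_set_cvg0 => //.
apply: (@le_lt_trans _ _ (1 - r)^-1%:E); last exact: ltry.
apply: lime_le; first exact: is_cvg_nneseries.
apply: nearW => n; apply: le_trans (lee_sum _ (fun i _ => Fr i)) _.
rewrite sumEFin lee_fin -[leRHS]mul1r ler_pdivlMr ?subr_gt0//.
have := subrX1 r n; rewrite big_mkord => E.
suff : 0 <= r ^+ n by lra.
exact: exprn_ge0.
Qed.

Lemma bern_singular w w' : 0 < w < 1 -> 0 < w' < 1 -> w != w' ->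
  exists A : set cantor, [/\ measurable A, bern w (~` A) = 0%E & bern w' A = 0%E].
Proof.
move=> w01 w'01 ww'.
have ms u u' : measurable (lim_sup_set (less_likely u u')).
  apply: bigcap_measurableType => n _; apply: bigcup_measurable => k _.
  exact: measurable_less_likely.
have null u u' : 0 < u < 1 -> 0 < u' < 1 -> u != u' ->
    bern u (lim_sup_set (less_likely u u')) = 0%E.
  move=> u01 u'01 uu'; apply: (@geometric_borel_cantelli _ _ _ _ (hell u u')).
  - by rewrite hell_ge0 hell_lt1.
  - exact: measurable_less_likely.
  - by move=> n; exact: bern_less_likely.
exists (~` lim_sup_set (less_likely w w')); split.
- exact: measurableC.
- by rewrite setCK null.
apply/eqP; rewrite eq_le measure_ge0 andbT -(null w' w)// 1?eq_sym//.
apply: le_measure; rewrite ?inE//; first exact: measurableC.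
(* A sequence in only finitely many [less_likely w w'] is in [less_likely w' w] from some index on,
   hence infinitely often. *)
move=> b nb n _; apply: contrapT => H; apply: nb => m _.
exists (maxn n m); rewrite /= ?leq_maxr// /less_likely /=.
rewrite leNgt; apply/negP => /ltW H'; apply: H.
by exists (maxn n m) => //=; rewrite leq_maxl.
Qed.

End BernoulliMixing.

(** * The measures on the Laakso space *)

HB.instance Definition _ (R : realType) := gen_eqMixin (@laakso R).
HB.instance Definition _ (R : realType) := gen_choiceMixin (@laakso R).
HB.instance Definition _ (R : realType) :=
  isPointed.Build (@laakso R) (lpt 0 (fun=> false)).

Section LaaksoMeasure.
Context {R : realType}.
Local Notation leb := (@lebesgue_measure R).
Implicit Types (s t p q h r : R) (w : R).

Definition lspace := g_sigma_algebraType
  [set O : set (@laakso R) | mopen (@ldist R) O].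
HB.instance Definition _ := Measurable.on lspace.

Lemma lspace_borel : @borel_for R _ lspace (@ldist R).
Proof. by []. Qed.

Lemma mopen_measurable (O : set lspace) : mopen (@ldist R) O -> measurable O.
Proof. by move=> oO; apply: sub_sigma_algebra. Qed.

Lemma mball_mopen x r : mopen (@ldist R) (mball (@ldist R) x r).
Proof.
move=> y; rewrite /mball /= => xy; exists (r - ldist x y); first lra.
by move=> z /= yz; have := ldist_tri x y z; lra.
Qed.

Lemma measurable_mball x r : measurable (mball (@ldist R) x r : set lspace).
Proof. by apply: mopen_measurable; exact: mball_mopen. Qed.

Definition lproj (z : measurableTypeR R * cantor) : lspace := lpt z.1 z.2.

Lemma lpt_clamp t b : lpt t b = lpt (clamp t) b.
Proof. by apply: laakso_eq => /=; rewrite (clamp_id (clamp01 t)). Qed.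

Lemma measurable_clamp : measurable_fun setT (clamp : measurableTypeR R -> R).
Proof.
have H : measurable_fun (setT : set (measurableTypeR R))
    ((cst 0 \max (cst 1 \min id)) : R -> R).
  by apply: measurable_maxr => //; exact: measurable_minr.
exact: H.
Qed.

(** The preimage of an open set is the union of the boxes (dyadic interval times cylinder) that it
    contains: there are countably many, and their images have arbitrarily small diameter. *)
Lemma measurable_lproj : measurable_fun setT lproj.
Proof.
apply: (@measurability _ _ _ lspace setT lproj
  [set O : set (@laakso R) | mopen (@ldist R) O] erefl).
move=> _ [A oO <-]; rewrite setTI.
pose box := fun i : nat * nat * seq bool =>
  ((clamp : measurableTypeR R -> R) @^-1` `[dy i.1.1 i.1.2, dy i.1.1 i.1.2.+1]) `*`
   (cyl i.1.1 (nth false i.2) : set cantor).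
have mbox i : measurable (box i).
  apply: measurableX; last exact: measurable_cyl.
  rewrite -[X in measurable X]setTI; apply: measurable_clamp => //.
rewrite (_ : _ @^-1` _ = \bigcup_(i in [set: nat * nat * seq bool])
    (if `[< box i `<=` lproj @^-1` A >] then box i else set0)).
  apply: countable_bigcupT_measurable => [|i]; first exact: countableP.
  by case: ifP => _ //; exact: measurable0.
apply/seteqP; split=> [[t b] Otb|z [i _]]; last first.
  by case: asboolP => [H /H|].
have [e e0 eO] := oO _ Otb.
have [n ne] := exp2_small e0.
have [j jn tj] := dyadic_cover n (clamp01 t).
exists (n, j, mkseq b n) => //; rewrite asboolT; last first.
  move=> [s c] /= [sj /= cb]; apply: eO; apply: le_lt_trans ne.
  rewrite /lproj /= in sj *; rewrite in_itv /= in sj.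
  rewrite (lpt_clamp t) (lpt_clamp s).
  apply: (@dbox_ldist R n j b) => //; apply: lpt_dbox => // k kn.
  by rewrite cb// nth_mkseq.
by split; rewrite /= ?in_itv//= => k kn; rewrite nth_mkseq.
Qed.

HB.instance Definition _ := isMeasurableFun.Build _ _ _ _ lproj measurable_lproj.

Lemma worm_gap k t : ~ worm k t -> exists2 r, 0 < r & ~ hit k (t - r) (t + r).
Proof.
move=> nw; suff [r r0 H] : exists2 r, 0 < r &
    forall j, (j < 2 ^ k)%N -> r < `|t - j.*2.+1%:R / 2 ^+ k.+1|.
  by exists r => // -[z [j jk ->] ?]; have := H j jk; rewrite ltNge ler_norml; lra.
have : forall j, (j < 2 ^ k)%N -> j.*2.+1%:R / 2 ^+ k.+1 <> t.
  by move=> j jk E; apply: nw; exists j.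
elim: (2 ^ k)%N => [|m IH] H; first by exists 1.
have [|r r0 Hr] := IH; first by move=> j jm; apply: H; exact: ltnW.
pose z := m.*2.+1%:R / 2 ^+ k.+1 : R.
have z0 : 0 < `|t - z|.
  by rewrite normr_gt0 subr_eq0; apply/eqP => E; exact: (H m).
exists (Num.min r (`|t - z| / 2)); first by rewrite lt_min r0; lra.
move=> j; rewrite ltnS leq_eqVlt gt_min => /orP[/eqP ->|jm]; last by rewrite Hr.
by rewrite -/z; apply/orP; right; lra.
Qed.

(** A point with digit [true] is not at a worm hole of level [k], so a small ball around it meets
    none and the digit is constant there. The value [false] is different, since both sheets meet at
    points carrying it. *)
Lemma dg_mopen k : mopen (@ldist R) [set x | dg x k = true].
Proof.
move=> x /= xk; have [|r r0 nh] := @worm_gap k (ht x).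
  by move=> wx; have [_ P] := laaksoP x; rewrite P in xk.
exists r => // y /=; rewrite -{1}(lpt_surj y) /mball /= => /ball_fiber.
move=> /(_ (ht01 y))[_ ->//] H; apply: nh; apply: hit_sub H.
  by rewrite /lo le_max lexx orbT.
by rewrite /hi ge_min lexx orbT.
Qed.

Definition ldigits (x : lspace) : cantor := dg x.

Lemma measurable_ldigits : measurable_fun setT ldigits.
Proof.
have mk k : measurable ([set x | dg x k = true] : set lspace).
  by apply: mopen_measurable; exact: dg_mopen.
apply: measurable_digits => k [|]; first exact: mk.
rewrite (_ : mkset _ = ~` [set x | dg x k = true]); first exact: measurableC.
by apply/seteqP; split=> x /=; rewrite /ldigits; case: (dg x k).
Qed.

Definition prodm w : probability (measurableTypeR R * cantor)%type R :=
  (unit_measure \x bern w)%E.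

Definition lmeas w : probability lspace R := distribution (prodm w) lproj.

Lemma prodmX w A B : measurable A -> measurable B ->
  prodm w (A `*` B) = (unit_measure A * bern w B)%E.
Proof. by move=> mA mB; exact: product_measure1E. Qed.

Lemma lmeasE w A : lmeas w A = prodm w (lproj @^-1` A).
Proof. by []. Qed.

Lemma unit_measureE (A : set (measurableTypeR R)) :
  unit_measure A = leb (A `&` `[0, 1]).
Proof. by []. Qed.

Lemma unit_out : unit_measure (~` `[(0:R), 1] : set (measurableTypeR R)) = 0%E.
Proof. by rewrite unit_measureE setICl measure0. Qed.

Lemma unit_itv p q : 0 <= p -> p <= q -> q <= 1 ->
  unit_measure (`[p, q] : set (measurableTypeR R)) = (q - p)%:E.
Proof.
move=> p0 pq q1; rewrite unit_measureE (_ : _ `&` _ = `[p, q]%classic).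
  rewrite lebesgue_measure_itv /= lte_fin; case: ltP => // ?.
  by congr EFin; lra.
by rewrite setIidl// => x /=; rewrite !in_itv /= => ?; lra.
Qed.

Lemma prodm_null w A B : measurable A -> measurable B ->
  unit_measure A = 0%E \/ bern w B = 0%E -> prodm w (A `*` B) = 0%E.
Proof.
by move=> mA mB [|] H; rewrite prodmX//; [rewrite H mul0e|rewrite H mule0].
Qed.

Lemma null_setU d (T : measurableType d) (mu : {measure set T -> \bar R})
    (A B : set T) : measurable A -> measurable B -> mu A = 0%E -> mu B = 0%E ->
  mu (A `|` B) = 0%E.
Proof.
move=> mA mB A0 B0; apply/eqP; rewrite eq_le measure_ge0 andbT.
have AB0 : (mu A + mu B = 0)%E by rewrite A0 B0 adde0.
by rewrite -AB0; exact: measureU2.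
Qed.

(** Digits survive the quotient map except at the countably many worm hole heights and outside
    [0, 1], which are null. Null sets of the Bernoulli law thus transfer to the space. *)
Lemma lmeas_ldigits w (B : set cantor) : measurable B -> bern w B = 0%E ->
  lmeas w (ldigits @^-1` B) = 0%E.
Proof.
move=> mB B0; rewrite lmeasE.
pose W : set (measurableTypeR R) := \bigcup_k [set t | worm k t].
have cW : countable W.
  apply: bigcup_countable => // k _.
  rewrite (_ : mkset _ = (fun j => j.*2.+1%:R / 2 ^+ k.+1) @` `I_(2 ^ k)).
    exact/finite_set_countable/finite_image/finite_II.
  by apply/seteqP; split=> t [j jk E]; exists j.
have mW : measurable W by exact: countable_measurable.
have uW : unit_measure W = 0%E.
  apply/eqP; rewrite eq_le measure_ge0 andbT unit_measureE.
  rewrite -(countable_lebesgue_measure0 cW); apply: le_measure => /=.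
  - by rewrite inE; apply: measurableI => //; exact: measurable_itv.
  - by rewrite inE.
  - exact: subIsetl.
have mout : measurable (~` `[(0:R), 1] : set (measurableTypeR R)).
  by apply: measurableC; exact: measurable_itv.
have mp : measurable (lproj @^-1` (ldigits @^-1` B)).
  have mb := measurable_ldigits measurableT mB; rewrite setTI in mb.
  by have := measurable_lproj measurableT mb; rewrite setTI.
have sub : lproj @^-1` (ldigits @^-1` B) `<=`
    (W `*` setT) `|` (((~` `[(0:R), 1]) `*` setT) `|` (setT `*` B)).
  move=> [t b]; rewrite /lproj /ldigits /= => Bt.
  have [t01|] := boolP (0 <= t <= 1); last first.
    by move=> nt; right; left; split=> //=; rewrite in_itv /=; exact/negP.
  have [Wt|nW] := pselect (W t); first by left.
  right; right; split=> //=; move: Bt; rewrite clamp_id//.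
  rewrite (_ : bitmask t b = b)//; apply/funext => k; apply: bitmask_id => wk.
  by apply: nW; exists k.
have m1 : measurable (W `*` (setT : set cantor)) by exact: measurableX.
have m2 : measurable
    ((~` `[(0:R), 1] : set (measurableTypeR R)) `*` (setT : set cantor)).
  exact: measurableX.
have m3 : measurable ((setT : set (measurableTypeR R)) `*` B) by exact: measurableX.
apply: (subset_measure0 mp _ sub).
  by apply: measurableU => //; exact: measurableU.
apply: null_setU => //; [exact: measurableU| |].
  by apply: prodm_null => //; left.
apply: null_setU => //; apply: prodm_null => //; [left|right] => //.
exact: unit_out.
Qed.

Lemma lmeas_singular w w' : 0 < w < 1 -> 0 < w' < 1 -> w != w' ->
  mutually_singular (lmeas w) (lmeas w').
Proof.
move=> w01 w'01 ww'; have [A [mA wA w'A]] := bern_singular w01 w'01 ww'.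
have mb := measurable_ldigits measurableT mA; rewrite setTI in mb.
exists (ldigits @^-1` A); split=> //; last exact: lmeas_ldigits.
have := @lmeas_ldigits w (~` A); rewrite preimage_setC; apply => //.
exact: measurableC.
Qed.

End LaaksoMeasure.

(** * Doubling *)

Section Doubling.
Context {R : realType}.
Implicit Types (s t p q h r : R) (w : R) (x : @laakso R).

Definition box x r : set (measurableTypeR R * cantor) :=
  `[lo x r, hi x r]%classic `*` fiber x r.

Lemma fiberE x r N : (forall k, (N <= k)%N -> hit k (lo x r) (hi x r)) ->
  fiber x r = [set b | forall k, (k < N)%N ->
    ~~ `[< hit k (lo x r) (hi x r) >] -> b k = dg x k].
Proof.
move=> HN; apply/seteqP; split=> b /= H k.
  by move=> _ /negP nh; apply: H => hk; apply: nh; exact/asboolP.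
move=> nh; have [kN|Nk] := ltnP k N; last by case: nh; exact: HN.
by apply: H => //; apply/negP => /asboolP.
Qed.

Lemma measurable_fiber x r : 0 < r -> measurable (fiber x r : set cantor).
Proof.
move=> r0; have [N HN] := hit_large x r0; rewrite (fiberE HN).
exact: (measurable_partial N (fun k => ~~ `[< hit k (lo x r) (hi x r) >])).
Qed.

Lemma measurable_box x r : 0 < r -> measurable (box x r).
Proof.
by move=> r0; apply: measurableX; [exact: measurable_itv|exact: measurable_fiber].
Qed.

Definition fmass w x r : R := fine (bern w (fiber x r)).
Definition bmass w x r : R := (hi x r - lo x r) * fmass w x r.

Lemma bern_fiber w x r N : 0 < w < 1 ->
  (forall k, (N <= k)%N -> hit k (lo x r) (hi x r)) ->
  fmass w x r = \prod_(k < N)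
    (if ~~ `[< hit k (lo x r) (hi x r) >] then wt w (dg x k) else 1).
Proof.
by move=> w01 HN; rewrite /fmass (fiberE HN)
  (bern_partial N (fun k => ~~ `[< hit k (lo x r) (hi x r) >])).
Qed.

Lemma fmass_gt0 w x r : 0 < w < 1 -> 0 < r -> 0 < fmass w x r.
Proof.
move=> w01 r0; have [N HN] := hit_large x r0; rewrite (bern_fiber w01 HN).
by apply: prodr_gt0 => k _; case: ifP => // _; exact: wt_gt0.
Qed.

Lemma bmass_gt0 w x r : 0 < w < 1 -> 0 < r -> 0 < bmass w x r.
Proof.
move=> w01 r0; have [_ lh _ _] := lohi x r0.
by rewrite mulr_gt0 ?fmass_gt0// subr_gt0.
Qed.

Lemma prodm_box w x r : 0 < r -> prodm w (box x r) = (bmass w x r)%:E.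
Proof.
move=> r0; have [l0 lh h1 _] := lohi x r0.
rewrite prodmX; [|exact: measurable_itv|exact: measurable_fiber].
rewrite unit_itv//; last exact: ltW.
rewrite /bmass /fmass EFinM fineK//.
by rewrite fin_num_measure//; exact: measurable_fiber.
Qed.

(** Doubling the radius at most doubles the interval and frees at most five levels, each costing a
    factor of at most 1 / min(w, 1 - w). *)
Definition dconst w : R := 2 / Num.min w (1 - w) ^+ 5.

Lemma dconst_ge1 w : 0 < w < 1 -> 1 <= dconst w.
Proof.
move=> w01; have th0 : 0 < Num.min w (1 - w) by rewrite lt_min; lra.
rewrite ler_pdivlMr ?exprn_gt0// mul1r.
apply: (@le_trans _ _ 1); last by rewrite ler1n.
by apply: exprn_ile1; [exact: ltW|rewrite ge_min; lra].
Qed.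

Lemma bmass_double w x r : 0 < w < 1 -> 0 < r ->
  bmass w x (2 * r) <= dconst w * bmass w x r.
Proof.
move=> w01 r0; have r20 : 0 < 2 * r by lra.
have [ll hh dd] := lohi_double x r0.
have [_ lh _ _] := lohi x r0; have [_ lh2 _ _] := lohi x r20.
have [N HN] := hit_large x r0.
have HN2 k : (N <= k)%N -> hit k (lo x (2 * r)) (hi x (2 * r)).
  by move=> /HN; exact: hit_sub.
have [s s5 sP] := new_levels x r0.
have th0 : 0 < Num.min w (1 - w) by rewrite lt_min; lra.
have th1 : Num.min w (1 - w) <= 1 by rewrite ge_min; lra.
have F : Num.min w (1 - w) ^+ 5 * fmass w x (2 * r) <= fmass w x r.
  rewrite (bern_fiber w01 HN) (bern_fiber w01 HN2).
  pose G (r : R) k := ~~ `[< hit k (lo x r) (hi x r) >].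
  apply: le_trans (@partial_compare _ w N (G (2 * r)) (G r) (dg x) s w01 _ _).
  - rewrite ler_wpM2r//; last by apply: ler_wiXn2l => //; exact: ltW.
    by apply: prodr_ge0 => k _; case: ifP => // _; apply: ltW; exact: wt_gt0.
  - move=> k; apply: contra => /asboolP H; apply/asboolP.
    exact: hit_sub H.
  - move=> k /negP nh; rewrite negbK => /asboolP h2; apply: sP => // h1.
    by apply: nh; apply/asboolP.
have f0 := fmass_gt0 x w01 r20.
rewrite /bmass /dconst; set T := _ ^+ 5 in F *.
have T0 : 0 < T by rewrite exprn_gt0.
rewrite (_ : 2 / T * _ = 2 * (hi x r - lo x r) * (fmass w x r / T)); last by ring.
by apply: ler_pM => //; [lra|exact: ltW|rewrite ler_pdivlMr// mulrC].
Qed.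

Lemma bmass_doubleX w x r n : 0 < w < 1 -> 0 < r ->
  bmass w x (2 ^+ n * r) <= dconst w ^+ n * bmass w x r.
Proof.
move=> w01 r0; elim: n => [|n IH]; first by rewrite !expr0 !mul1r.
rewrite !exprS -(mulrA 2) -(mulrA (dconst w)).
apply: le_trans (bmass_double _ w01 _) _.
  by rewrite mulr_gt0// exprn_gt0.
by apply: ler_wpM2l => //; have := dconst_ge1 w01; lra.
Qed.

Lemma measurable_ball_preimage x r :
  measurable (lproj @^-1` (mball (@ldist R) x r : set lspace)).
Proof.
by have := measurable_lproj measurableT (measurable_mball x r); rewrite setTI.
Qed.

(** Clamping sends these points into the space too, so preimages of balls may contain some of them;
    they carry no mass. *)
Definition outside : set (measurableTypeR R * cantor) :=
  (~` `[(0:R), 1]%classic) `*` setT.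

Lemma measurable_outside : measurable outside.
Proof. by apply: measurableX => //; apply: measurableC; exact: measurable_itv. Qed.

Lemma prodm_outside w : prodm w outside = 0%E.
Proof.
apply: prodm_null => //; last by left; exact: unit_out.
by apply: measurableC; exact: measurable_itv.
Qed.

Lemma ball_sub_box x r :
  lproj @^-1` (mball (@ldist R) x r : set lspace) `<=` box x r `|` outside.
Proof.
move=> [t b] /= xb; have [t01|nt] := boolP (0 <= t <= 1).
  by left; have [tI bC] := ball_fiber t01 xb; split.
by right; split=> //=; rewrite in_itv /=; apply/negP.
Qed.

Lemma box_sub_ball x r : 0 < r ->
  box x r `<=` lproj @^-1` (mball (@ldist R) x (5 * r) : set lspace).
Proof.
by move=> r0 [t b] [/= tI bC]; apply: fiber_ball => //; rewrite in_itv in tI.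
Qed.

Lemma lmeas_ball_le w x r : 0 < r ->
  (lmeas w (mball (@ldist R) x r) <= (bmass w x r)%:E)%E.
Proof.
move=> r0; rewrite lmeasE -prodm_box//.
have mb := measurable_box x r0; have mo := measurable_outside.
apply: (@le_trans _ _ (prodm w (box x r `|` outside))).
  apply: le_measure; rewrite ?inE//; [exact: measurable_ball_preimage|
    exact: measurableU|exact: ball_sub_box].
have E : (prodm w (box x r) + prodm w outside = prodm w (box x r))%E.
  by rewrite prodm_outside adde0.
by rewrite -[leRHS]E; exact: measureU2.
Qed.

Lemma lmeas_ball_ge w x r : 0 < r ->
  ((bmass w x r)%:E <= lmeas w (mball (@ldist R) x (5 * r)))%E.
Proof.
move=> r0; rewrite lmeasE -prodm_box//; apply: le_measure; rewrite ?inE.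
- exact: measurable_box.
- exact: measurable_ball_preimage.
- exact: box_sub_ball.
Qed.

Lemma mball_sub x r r' : r <= r' -> mball (@ldist R) x r `<=` mball (@ldist R) x r'.
Proof. by move=> rr' y; rewrite /mball /=; lra. Qed.

(** Compare with boxes at both ends: the ball of radius 2r is controlled by its box, four halvings
    lead to the box of radius r/8, and that box projects into the ball of radius 5r/8. *)
Lemma lmeas_ball_double w x r : 0 < w < 1 -> 0 < r ->
  (lmeas w (mball (@ldist R) x (2 * r)) <=
   (dconst w ^+ 4)%:E * lmeas w (mball (@ldist R) x r))%E.
Proof.
move=> w01 r0; have r8 : 0 < r / 8 by lra.
apply: (le_trans (lmeas_ball_le w x _)); first lra.
have H := bmass_doubleX x 4 w01 r8.
have E : 2 ^+ 4 * (r / 8) = 2 * r by rewrite !exprS expr0; lra.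
rewrite E in H; apply: (@le_trans _ _ (dconst w ^+ 4 * bmass w x (r / 8))%:E).
  by rewrite lee_fin.
rewrite EFinM; apply: lee_wpmul2l.
  by rewrite lee_fin exprn_ge0//; have := dconst_ge1 w01; lra.
apply: le_trans (lmeas_ball_ge w x r8) _; apply: le_measure; rewrite ?inE.
- exact: measurable_mball.
- exact: measurable_mball.
- by apply: mball_sub; lra.
Qed.

Lemma lmeas_ball_fin w x r : lmeas w (mball (@ldist R) x r) \is a fin_num.
Proof. by rewrite fin_num_measure//; exact: measurable_mball. Qed.

Lemma lmeas_ball_gt0 w x r : 0 < w < 1 -> 0 < r ->
  (0 < lmeas w (mball (@ldist R) x r))%E.
Proof.
move=> w01 r0; have r5 : 0 < r / 5 by lra.
have := lmeas_ball_ge w x r5; rewrite (_ : 5 * (r / 5) = r); last by lra.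
by apply: lt_le_trans; rewrite lte_fin bmass_gt0.
Qed.

Lemma lmeas_doubling w : 0 < w < 1 -> @doubling R _ lspace (@ldist R) (lmeas w).
Proof.
move=> w01; exists (dconst w ^+ 4).
  by rewrite exprn_ege1// dconst_ge1.
move=> x r r0; split; first by apply: lmeas_ball_gt0 => //; lra.
split; first exact: lmeas_ball_double.
by rewrite ltey_eq fin_numM//; exact: lmeas_ball_fin.
Qed.

End Doubling.

(** * Integration lemmas *)

Section Integrals.
Context {R : realType}.
Local Notation leb := (@lebesgue_measure R).

Definition shift (p : R) : measurableTypeR R -> measurableTypeR R := fun t => p + t.

Lemma measurable_shift p : measurable_fun setT (shift p).
Proof.
have H : measurable_fun (setT : set (measurableTypeR R)) ((cst p \+ id) : R -> R).
  by apply: measurable_funD.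
exact: H.
Qed.

HB.instance Definition _ p :=
  isMeasurableFun.Build _ _ _ _ (shift p) (measurable_shift p).

Lemma lebesgue_shift p (A : set (measurableTypeR R)) : measurable A ->
  pushforward leb (shift p) A = leb A.
Proof.
move=> mA; apply/esym/lebesgue_measure_unique => //= _ [[a b]] _ <-.
rewrite /pushforward /= (_ : shift p @^-1` _ = `](a - p), (b - p)]%classic).
  rewrite !lebesgue_measure_itv/= !lte_fin ltrBlDr subrK.
  by case: ifP => // _; rewrite -!EFinD; congr EFin; ring.
by apply/seteqP; split=> t /=; rewrite /shift !in_itv /=; lra.
Qed.

Lemma integral_shift p L (F : measurableTypeR R -> \bar R) :
  measurable_fun setT F -> (forall t, 0 <= F t)%E ->
  (\int[leb]_(t in [set t : R | (0 <= t <= L)%R]) F (p + t)%R =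
   \int[leb]_(h in `[p, (p + L)%R]) F h)%E.
Proof.
move=> mF F0.
rewrite (_ : [set t : R | (0 <= t <= L)%R] = shift p @^-1` `[p, p + L]%classic).
  rewrite -(@ge0_integral_pushforward _ _ _ _ _ (shift p) (measurable_shift p)
    leb `[p, p + L]%classic F) //; last exact: measurable_funTS.
  by apply: eq_measure_integral => A mA _; exact: lebesgue_shift.
by apply/seteqP; split=> t /=; rewrite /shift in_itv /=; lra.
Qed.

Lemma integral_unit_itv p q (F : measurableTypeR R -> \bar R) :
  0 <= p -> q <= 1 ->
  (\int[leb]_(h in `[p, q]) F h = \int[unit_measure]_(h in `[p, q]) F h)%E.
Proof.
move=> p0 q1; apply: eq_measure_integral => A mA Apq.
suff E : unit_measure A = leb A by exact: esym E.
by rewrite unit_measureE setIidl// => t /Apq /=; rewrite !in_itv /=; lra.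
Qed.

(** The mean differs from [c] by at most the average of |u - c|, so replacing the mean by any
    constant costs a factor 2. *)
Lemma mean_oscillation d (T : measurableType d) (mu : probability T R)
    (B : set T) (u : T -> R) (c : R) : measurable B ->
  (0 < mu B)%E -> mu.-integrable B (EFin \o u) ->
  (\int[mu]_(y in B) (`|u y - ball_mean mu B u|)%:E <=
   2%:E * \int[mu]_(y in B) (`|u y - c|)%:E)%E.
Proof.
move=> mB B0 iu; set m := ball_mean mu B u.
have Bf : mu B \is a fin_num by exact: fin_num_measure.
have fB0 : 0 < fine (mu B) by rewrite fine_gt0// B0 ltey_eq Bf.
have ic v : mu.-integrable B (EFin \o cst v) by exact: finite_measure_integrable_cst.
have Ic v : (\int[mu]_(x in B) cst v%:E x = (v * fine (mu B))%:E)%E.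
  rewrite integral_cst//; transitivity (v%:E * (fine (mu B))%:E)%E => //.
  by rewrite fineK.
have mu_ : measurable_fun B u by exact/measurable_EFinP/(measurable_int mu).
have md v : measurable_fun B (fun y => `|u y - v|%:E).
  by apply/measurable_EFinP/measurableT_comp => //; exact: measurable_funB.
set J := (\int[mu]_(y in B) (`|u y - c|)%:E)%E.
have E1 : (\int[mu]_(y in B) ((u y)%:E - (cst c y)%:E) = ((m - c) * fine (mu B))%:E)%E.
  rewrite integralB_EFin// Ic.
  have /fineK <- : (\int[mu]_(x in B) (u x)%:E)%E \is a fin_num.
    exact: integrable_fin_num.
  rewrite -EFinB; congr EFin.
  by rewrite mulrBl /m /ball_mean divfK// gt_eqF.
have E2 : ((`|m - c| * fine (mu B))%:E <= J)%E.
  have -> : `|m - c| * fine (mu B) = `|(m - c) * fine (mu B)|.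
    by rewrite normrM (gtr0_norm fB0).
  rewrite -abse_EFin -E1; apply: le_trans (le_abse_integral _ mB _) _ => //.
  by apply/measurable_EFinP; exact: measurable_funB.
apply: (@le_trans _ _ (\int[mu]_(y in B) ((`|u y - c|)%:E + (cst `|m - c| y)%:E))%E).
  apply: ge0_le_integral; [by []|by []|exact: md| |].
    by apply: emeasurable_funD; [exact: md|exact/measurable_EFinP].
  move=> y _ /=; rewrite -EFinD lee_fin.
  rewrite (_ : u y - m = (u y - c) - (m - c)); last by ring.
  exact: ler_normB.
rewrite ge0_integralD; [|by []|by move=> *; rewrite lee_fin|exact: md|
  by move=> *; rewrite lee_fin|exact/measurable_EFinP].
rewrite Ic -/J.
have -> : (2%:E * J = J + J)%E.
  by rewrite (_ : 2%:E = 1 + 1)%E// ?ge0_muleDl ?mul1e.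
by rewrite leeD2l.
Qed.

(** A function on a probability space cannot exceed its integral by [e] everywhere. This will pick
    one good target sequence [b]. *)
Lemma exists_le_integral d (T : measurableType d) (mu : probability T R)
    (H : T -> \bar R) (N e : R) : 0 < e -> measurable_fun setT H ->
  (forall x, (0 <= H x)%E) -> (\int[mu]_x H x <= N%:E)%E ->
  exists x, (H x <= (N + e)%:E)%E.
Proof.
move=> e0 mH H0 HN; apply: contrapT => /forallNP nH.
have lt x : ((N + e)%:E <= H x)%E by have /negP := nH x; rewrite -ltNge => /ltW.
have N0 : 0 <= N.
  by rewrite -lee_fin; apply: le_trans HN; exact: integral_ge0.
have : (\int[mu]_x (cst (N + e)%:E x) <= N%:E)%E.
  apply: le_trans HN; apply: ge0_le_integral => // x _.
  by rewrite /= lee_fin; lra.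
rewrite integral_cst// [X in (_ * X)%E]probability_setT mule1 lee_fin; lra.
Qed.

End Integrals.

(** * The Poincare inequality *)

Section Poincare.
Context {R : realType}.
Local Notation leb := (@lebesgue_measure R).
Implicit Types (s t p q h r : R) (w : R) (x : @laakso R).
Local Notation rT := (measurableTypeR R).

Definition mixm p (z : rT * (cantor * cantor)) : cantor := mix p z.2.1 z.2.2 z.1.

Lemma measurable_hit k p : measurable ([set h | hit k p h] : set rT).
Proof.
pose z j : R := (j.*2.+1)%:R / 2 ^+ k.+1.
rewrite (_ : mkset _ = \bigcup_(j in [set j | (j < 2 ^ k)%N /\ p <= z j])
    `[z j, +oo[%classic).
  by apply: bigcup_measurable => j _; exact: measurable_itv.
apply/seteqP; split=> h /=.
  move=> [_ [j jk ->] /andP[pz zh]]; exists j => //=.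
  by rewrite in_itv /= zh.
move=> [j [jk pz]]; rewrite /= in_itv /= andbT => zh.
by exists (z j); [exists j|rewrite pz].
Qed.

Lemma measurable_mixm p : measurable_fun setT (mixm p).
Proof.
apply: measurable_digits => k e.
have mh : measurable ([set z | hit k p z.1] : set (rT * (cantor * cantor))).
  rewrite -[X in measurable X]setTI.
  exact: (measurable_fst measurableT _ (measurable_hit k p)).
have m1 : measurable ([set z | z.2.1 k = e] : set (rT * (cantor * cantor))).
  apply: (@measurable_fun_digit _ _ (fun z : rT * (cantor * cantor) => z.2.1)).
  exact: measurableT_comp.
have m2 : measurable ([set z | z.2.2 k = e] : set (rT * (cantor * cantor))).
  apply: (@measurable_fun_digit _ _ (fun z : rT * (cantor * cantor) => z.2.2)).
  exact: measurableT_comp.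
rewrite (_ : mkset _ = ([set z | hit k p z.1] `&` [set z | z.2.2 k = e]) `|`
    ((~` [set z | hit k p z.1]) `&` [set z | z.2.1 k = e])).
  by apply: measurableU; apply: measurableI => //; exact: measurableC.
apply/seteqP; split=> -[h [a b]]; rewrite /mixm /=;
  have [H|H] := pselect (hit k p h).
- by rewrite mixT//; left.
- by rewrite mixF//; right.
- by rewrite mixT// => -[[]|[]].
- by rewrite mixF// => -[[]|[]].
Qed.

Definition mpair p (z : rT * (cantor * cantor)) : rT * cantor := (z.1, mixm p z).

Lemma measurable_mpair p : measurable_fun setT (mpair p).
Proof. by apply/measurable_fun_pair => //; exact: measurable_mixm. Qed.

(** The integral is extended from [p, s] to [p, q] so that the bound no longer depends on [s]. *)
Lemma upper_gradient_path (u : @laakso R -> R) (rho : lspace -> \bar R) p q s a b :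
  (forall y, (0 <= rho y)%E) -> measurable_fun setT rho ->
  upper_gradient (@ldist R) u rho -> 0 <= p -> p <= s -> s <= q -> q <= 1 ->
  (`|u (lpt p a) - u (lpt s (mix p a b s))|%:E <=
   \int[unit_measure]_(h in `[p, q]) rho (lproj (mpair p (h, (a, b)))))%E.
Proof.
move=> rho0 mrho ug p0 ps sq q1.
have mF : measurable_fun (setT : set rT) (fun h => rho (lproj (mpair p (h, (a, b))))).
  have m1 : measurable_fun (setT : set rT) (fun h => (h, (a, b) : cantor * cantor)).
    exact/measurable_fun_pair.
  exact: (measurableT_comp mrho (measurableT_comp measurable_lproj
    (measurableT_comp (@measurable_mpair p) m1))).
apply: le_trans (upper_gradient_mix a b ug p0 ps (le_trans sq q1)) _.
rewrite /line_integral (integral_shift p (s - p) mF)//.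
rewrite (_ : p + (s - p) = s); last by ring.
rewrite integral_unit_itv//; last exact: (le_trans sq q1).
apply: ge0_subset_integral => //; first exact: measurable_funTS.
by move=> h /=; rewrite !in_itv /= => /andP[-> hs]; exact: le_trans sq.
Qed.

Definition bern2 w : probability (cantor * cantor)%type R :=
  (bern w \x bern w)%E.

(** Tonelli moves the height outermost. At fixed height the mixed sequence is a [select] of two
    independent Bernoulli sequences, so by [bern_select] it is again Bernoulli. *)
Lemma integral_mix w p (Psi : rT * cantor -> \bar R) : 0 < w < 1 ->
  measurable_fun setT Psi -> (forall z, (0 <= Psi z)%E) ->
  (\int[bern w]_b \int[bern w]_a \int[unit_measure]_h Psi (mpair p (h, (a, b))) =
   \int[prodm w]_z Psi z)%E.
Proof.
move=> w01 mPsi Psi0.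
pose Phi := Psi \o mpair p.
have mPhi : measurable_fun setT Phi.
  by apply: measurableT_comp => //; exact: measurable_mpair.
have Phi0 z : (0 <= Phi z)%E by exact: Psi0.
have mH := @measurable_fun_fubini_tonelli_G _ _ _ _ _ unit_measure Phi mPhi Phi0.
have H0 z : (0 <= fubini_G unit_measure Phi z)%E by exact: integral_ge0.
have E1 := @fubini_tonelli2 _ _ _ _ R (bern w) (bern w) _ mH H0.
have E2 := @fubini_tonelli _ _ _ _ R unit_measure (bern2 w) Phi mPhi Phi0.
have E3 := @fubini_tonelli1 _ _ _ _ R unit_measure (bern w) Psi mPsi Psi0.
rewrite [RHS]E3 -[LHS]E1 -[LHS]E2.
apply: eq_integral => h _; rewrite /fubini_F.
pose F k := `[< hit k p h >].
have mPh : measurable_fun setT (fun c : cantor => Psi (h, c)).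
  by apply: measurableT_comp => //; exact/measurable_fun_pair.
transitivity (\int[distribution (bern2 w) (select F)]_c Psi (h, c))%E.
  by rewrite ge0_integral_pushforward.
apply: eq_measure_integral => A mA _.
exact: bern_select.
Qed.

(** Only levels with a worm hole in the interval are switched, so the path stays in the box whatever
    [b] is. *)
Lemma mix_fiber x r p a b h : h <= hi x r -> p = lo x r ->
  fiber x r a -> fiber x r (mix p a b h).
Proof.
move=> hh -> ax k nh; rewrite mixF; first exact: ax.
by move=> H; apply: nh; exact: hit_sub H.
Qed.

(** Pass from (s, a) straight to the bottom (p, a), then along the mixed path towards [b] up to the
    top. The gradient on the first leg integrates over [a] to N, on the second to at most N + e for
    a good [b], and integrating over [s] gives a factor of at most 2r. *)
Lemma box_oscillation w x r (u : @laakso R -> R) (rho : lspace -> \bar R) (N e : R) :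
  0 < w < 1 -> 0 < r -> 0 < e ->
  measurable_fun setT (u : lspace -> R) ->
  (forall y, (0 <= rho y)%E) -> measurable_fun setT rho ->
  upper_gradient (@ldist R) u rho ->
  (\int[prodm w]_(z in box x r) rho (lproj z) = N%:E)%E ->
  exists c, (\int[prodm w]_(z in box x r) `|u (lproj z) - c|%:E <=
             ((2 * N + e) * (2 * r))%:E)%E.
Proof.
move=> w01 r0 e0 mu_ rho0 mrho ug NE.
have [l0 lh h1 [_ d2 _]] := lohi x r0.
set p := lo x r in l0 lh d2 *; set q := hi x r in lh h1 d2 *.
have mB := measurable_box x r0.
have mrl : measurable_fun setT (rho \o lproj).
  by apply: measurableT_comp => //; exact: measurable_lproj.
(* The gradient along the mixed path from [a] to [b] at height [h] is
   [Psi (mpair p (h, (a, b)))], and [H1 b] averages its integral over [a]. *)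
pose Psi := (rho \o lproj) \_ (box x r).
have mPsi : measurable_fun setT Psi.
  by apply: (measurable_restrict (rho \o lproj) mB measurableT).1;
    exact: (measurable_funTS mrl).
have Psi0 z : (0 <= Psi z)%E.
  by rewrite /Psi patchE; case: ifP => // _; exact: rho0.
have PsiN : (\int[prodm w]_z Psi z = N%:E)%E by rewrite -NE [RHS]integral_mkcond.
have mPhi : measurable_fun setT (Psi \o mpair p).
  by apply: measurableT_comp => //; exact: measurable_mpair.
pose H2 (z : cantor * cantor) := (\int[unit_measure]_h Psi (mpair p (h, z)))%E.
have mH2 : measurable_fun setT H2.
  exact: (@measurable_fun_fubini_tonelli_G _ _ _ _ _ unit_measure
    (Psi \o mpair p) mPhi (fun z => Psi0 _)).
have H20 z : (0 <= H2 z)%E by exact: integral_ge0.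
pose H1 b := (\int[bern w]_a H2 (a, b))%E.
have mH1 : measurable_fun setT H1.
  exact: (@measurable_fun_fubini_tonelli_G _ _ _ _ _ (bern w) H2 mH2 H20).
have H1N : (\int[bern w]_b H1 b <= N%:E)%E.
  by rewrite -PsiN -(integral_mix p w01 mPsi Psi0).
have [b Hb] : exists b, (H1 b <= (N + e)%:E)%E.
  apply: (exists_le_integral e0 mH1 _ H1N) => c; exact: integral_ge0.
pose A1 a := (\int[unit_measure]_h Psi (h, a))%E.
have mA1 : measurable_fun setT A1.
  exact: (@measurable_fun_fubini_tonelli_G _ _ _ _ _ unit_measure Psi mPsi Psi0).
have A10 a : (0 <= A1 a)%E by exact: integral_ge0.
have A1N : (\int[bern w]_a A1 a = N%:E)%E.
  by rewrite -PsiN; exact/esym/(@fubini_tonelli2 _ _ _ _ R unit_measure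
    (bern w) Psi mPsi Psi0).
pose K a := (A1 a + H2 (a, b))%E.
have mHb : measurable_fun setT (fun a => H2 (a, b)).
  by apply: measurableT_comp => //; exact/measurable_fun_pair.
have mK : measurable_fun setT K by exact: emeasurable_funD.
have K0 a : (0 <= K a)%E by rewrite adde_ge0.
have KN : (\int[bern w]_a K a <= (2 * N + e)%:E)%E.
  rewrite ge0_integralD//; rewrite A1N.
  by rewrite (_ : 2 * N + e = N + (N + e)); [rewrite EFinD leeD2l|ring].
(* The value at the top of the mixed path; for [a] in the fiber the end point does not depend on
   [a], since levels that are not hit carry the digits of [x]. *)
pose c := u (lpt q (fun k => if `[< hit k p q >] then b k else dg x k)).
have path_le a b' s : fiber x r a -> p <= s <= q ->
    (`|u (lpt p a) - u (lpt s (mix p a b' s))|%:E <= H2 (a, b'))%E.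
  move=> ax /andP[ps sq].
  apply: le_trans (upper_gradient_path a b' rho0 mrho ug l0 ps sq h1) _.
  rewrite integral_mkcond; apply: ge0_le_integral => //.
  - by move=> h _; rewrite patchE; case: ifP => // _; exact: rho0.
  - apply/(measurable_restrict _ _ _).1 => //; apply: measurable_funTS.
    have m1 : measurable_fun (setT : set rT) (fun h => (h, (a, b') : cantor * cantor)).
      exact/measurable_fun_pair.
    exact: (measurableT_comp mrho (measurableT_comp measurable_lproj
      (measurableT_comp (@measurable_mpair p) m1))).
  - apply: (measurableT_comp mPhi); exact/measurable_fun_pair.
  - move=> h _; rewrite patchE; case: ifPn => [|_]; last exact: Psi0.
    rewrite inE /= in_itv /= => /andP[ph hq].
    rewrite /Psi patchE ifT// inE; split; rewrite /= ?in_itv /= ?ph ?hq//.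
    exact: mix_fiber.
have point_le z : box x r z -> (`|u (lproj z) - c|%:E <= K z.2)%E.
  case: z => s a [/= sI ax]; rewrite in_itv /= in sI.
  have A : (`|u (lpt p a) - u (lproj (s, a))|%:E <= A1 a)%E.
    have := path_le a a s ax sI; rewrite mix_same.
    by rewrite /H2 /mpair /mixm /=; under eq_integral do rewrite mix_same.
  have B : (`|u (lpt p a) - c|%:E <= H2 (a, b))%E.
    have := path_le a b q ax; rewrite lexx (ltW lh) => /(_ isT).
    rewrite (_ : mix p a b q = fun k => if `[< hit k p q >] then b k else dg x k)//.
    apply/funext => k; have [H|H] := pselect (hit k p q).
      by rewrite mixT// asboolT.
    by rewrite mixF// asboolF// ax.
  apply: le_trans (leeD A B); rewrite -EFinD lee_fin.
  rewrite (_ : u (lproj (s, a)) - c =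
    (u (lpt p a) - c) - (u (lpt p a) - u (lproj (s, a)))); last by ring.
  by rewrite [leRHS]addrC; exact: ler_normB.
have mI : measurable (`[p, q]%classic `*` setT : set (rT * cantor)).
  by apply: measurableX.
have mKs : measurable_fun setT (fun z : rT * cantor => K z.2).
  exact: (measurableT_comp mK measurable_snd).
exists c.
(* On the full strip the integrand depends on the digits only, so integrating over heights just
   multiplies by q - p. *)
apply: (@le_trans _ _ (\int[prodm w]_(z in `[p, q] `*` setT) K z.2)%E).
  apply: (@le_trans _ _ (\int[prodm w]_(z in box x r) K z.2)%E).
    apply: ge0_le_integral => //.
    - apply/measurable_EFinP; apply: measurable_funTS.
      apply: measurableT_comp => //; apply: measurable_funB => //.
      exact: (measurableT_comp mu_ measurable_lproj).
    - exact: measurable_funTS.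
  apply: ge0_subset_integral => //; first exact: measurable_funTS.
  by move=> z [].
rewrite integral_mkcond.
have mKr : measurable_fun setT ((fun z : rT * cantor => K z.2) \_ (`[p, q] `*` setT)).
  by apply: (measurable_restrict (fun z : rT * cantor => K z.2) mI measurableT).1;
    exact: (measurable_funTS mKs).
have Kr0 z : (0 <= ((fun z : rT * cantor => K z.2) \_ (`[p, q] `*` setT)) z)%E.
  by rewrite patchE; case: ifP.
have E1 := @fubini_tonelli2 _ _ _ _ R unit_measure (bern w) _ mKr Kr0.
rewrite [leLHS]E1 /fubini_G.
have inner a : (\int[unit_measure]_s
    ((fun z : rT * cantor => K z.2) \_ (`[p, q] `*` setT)) (s, a) =
    K a * (q - p)%:E)%E.
  transitivity (\int[unit_measure]_(s in `[p, q]) cst (K a) s)%E.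
    rewrite [RHS]integral_mkcond; apply: eq_integral => s _.
    rewrite !patchE /=; congr (if _ then _ else _).
    by apply/idP/idP; rewrite !inE => //= -[].
  rewrite integral_cst//; congr (_ * _)%E.
  by apply: unit_itv => //; exact: ltW.
under eq_integral do rewrite inner.
rewrite ge0_integralZr//; last by rewrite lee_fin; lra.
rewrite EFinM; apply: lee_pmul => //.
- exact: integral_ge0.
- by rewrite lee_fin; lra.
Qed.

End Poincare.

(** * From boxes to balls *)

Section PoincareBalls.
Context {R : realType}.
Implicit Types (s t p q h r : R) (w : R) (x : @laakso R).

Lemma ldist_le2 x y : ldist x y <= 2.
Proof.
have x01 := ht01 x; have y01 := ht01 y.
have /ldist_le : feasible (ht x) (dg x) (ht y) (dg y) 0 1.
  by split; try lra; move=> k _; exact: hit01.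
by have := normr_ge0 (ht x - ht y); lra.
Qed.

Lemma measurable_of_integrable w (u : @laakso R -> R) :
  (forall z s, 0 < s ->
    (lmeas w).-integrable (mball (@ldist R) z s : set lspace) (EFin \o u)) ->
  measurable_fun setT (u : lspace -> R).
Proof.
(* The diameter is at most 2, so a ball of radius 3 is the whole space. *)
move=> /(_ (lpt 0 (fun=> false)) 3 ltac:(lra))/measurable_int/measurable_EFinP.
rewrite (_ : mball _ _ _ = setT)//; apply/seteqP; split=> // y _.
by rewrite /mball /=; have := ldist_le2 (lpt 0 (fun=> false)) y; lra.
Qed.

Lemma ball_integral_le w x r (f : lspace -> \bar R) : 0 < r ->
  measurable_fun setT f -> (forall y, (0 <= f y)%E) ->
  (\int[lmeas w]_(y in mball (@ldist R) x r) f y <=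
   \int[prodm w]_(z in box x r) f (lproj z))%E.
Proof.
move=> r0 mf f0.
have mfl : measurable_fun setT (f \o lproj) := measurableT_comp mf measurable_lproj.
rewrite [leLHS](_ : _ =
    \int[prodm w]_(z in lproj @^-1` (mball (@ldist R) x r : set lspace))
      (f \o lproj) z)%E.
  have mb := measurable_box x r0; have mo := @measurable_outside R.
  apply: (@le_trans _ _ (\int[prodm w]_(z in box x r `|` outside) (f \o lproj) z)%E).
    apply: ge0_subset_integral.
    - exact: measurable_ball_preimage.
    - exact: measurableU.
    - exact: measurable_funTS.
    - by move=> z _; exact: f0.
    - exact: ball_sub_box.
  rewrite ge0_integral_setU//.
  - rewrite [X in (_ + X)%E]null_set_integral ?adde0//.
      exact: measurable_funTS.
    exact: prodm_outside.
  - exact: measurable_funTS.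
  - by move=> z _; exact: f0.
  - apply/disj_setPS => z [[zI _] [zo _]]; apply: zo.
    have [l0 lh h1 _] := lohi x r0.
    by move: zI; rewrite /= !in_itv /=; lra.
apply: ge0_integral_pushforward => //; first exact: measurable_mball.
exact: measurable_funTS.
Qed.

Lemma box_integral_le w x r (f : lspace -> \bar R) : 0 < r ->
  measurable_fun setT f -> (forall y, (0 <= f y)%E) ->
  (\int[prodm w]_(z in box x r) f (lproj z) <=
   \int[lmeas w]_(y in mball (@ldist R) x (5 * r)) f y)%E.
Proof.
move=> r0 mf f0.
have mfl : measurable_fun setT (f \o lproj) := measurableT_comp mf measurable_lproj.
rewrite [leRHS](_ : _ =
  \int[prodm w]_(z in lproj @^-1` (mball (@ldist R) x (5 * r) : set lspace))
    (f \o lproj) z)%E.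
  apply: ge0_subset_integral.
  - exact: measurable_box.
  - exact: measurable_ball_preimage.
  - exact: measurable_funTS.
  - by move=> z _; exact: f0.
  - exact: box_sub_ball.
apply: ge0_integral_pushforward => //; first exact: measurable_mball.
exact: measurable_funTS.
Qed.

Definition ballm w x r : R := fine (lmeas w (mball (@ldist R) x r)).

Lemma ballm_gt0 w x r : 0 < w < 1 -> 0 < r -> 0 < ballm w x r.
Proof.
move=> w01 r0; rewrite /ballm fine_gt0// lmeas_ball_gt0//=.
by rewrite ltey_eq lmeas_ball_fin.
Qed.

(** Three doublings, as 5r is below 8r. *)
Lemma ballm_le w x r : 0 < w < 1 -> 0 < r ->
  ballm w x (5 * r) <= (dconst w ^+ 4) ^+ 3 * ballm w x r.
Proof.
move=> w01 r0; have D1 : 1 <= dconst w ^+ 4 by rewrite exprn_ege1// dconst_ge1.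
set D := dconst w ^+ 4 in D1 *.
have dbl s : 0 < s -> ballm w x (2 * s) <= D * ballm w x s.
  move=> s0; rewrite -lee_fin EFinM /ballm !fineK ?lmeas_ball_fin//.
  exact: lmeas_ball_double.
have le8 : ballm w x (5 * r) <= ballm w x (2 * (2 * (2 * r))).
  rewrite /ballm fine_le ?lmeas_ball_fin//; apply: le_measure; rewrite ?inE.
  - exact: measurable_mball.
  - exact: measurable_mball.
  - by apply: mball_sub; lra.
apply: (le_trans le8); apply: (le_trans (dbl _ _)); first lra.
rewrite exprS -mulrA; apply: ler_wpM2l; first lra.
apply: (le_trans (dbl _ _)); first lra.
rewrite expr2 -mulrA; apply: ler_wpM2l; first lra.
exact: dbl.
Qed.

Lemma lmeas_poincare w : 0 < w < 1 -> @poincare11 R _ lspace (@ldist R) (lmeas w).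
Proof.
move=> w01; set D := (dconst w ^+ 4) ^+ 3.
have D0 : 0 < D by rewrite exprn_gt0// exprn_gt0//; have := dconst_ge1 w01; lra.
(* The dilation 5 is that of a ball containing the box. The 8 is the factor 2 of [mean_oscillation]
   times (2N)(2r) from [box_oscillation], and [D] compares the masses of the two balls. *)
exists (8 * D), 5; first by split; lra.
move=> x r r0 u iu rho rho0 mrho ug; cbv zeta.
set B := mball _ x r; set lB := mball _ x (5 * r).
have mu_ := measurable_of_integrable iu.
have b0 := ballm_gt0 x w01 r0.
have r50 : 0 < 5 * r by lra.
have lb0 := ballm_gt0 x w01 r50.
rewrite -/(ballm w x r) -/(ballm w x (5 * r)).
set S := (\int[_]_(y in lB) rho y)%E.
have S0 : (0 <= S)%E by apply: integral_ge0.
have NS := box_integral_le w x r0 mrho rho0.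
set N := (\int[prodm w]_(z in box x r) rho (lproj z))%E in NS.
have N0 : (0 <= N)%E by apply: integral_ge0.
have C0 : 0 < 8 * D * r / ballm w x (5 * r).
  by apply: divr_gt0 => //; apply: mulr_gt0 => //; apply: mulr_gt0.
have [->|Soo] := eqVneq S +oo%E.
  by rewrite gt0_muley ?lte_fin// leey.
have Nf : N \is a fin_num.
  by rewrite ge0_fin_numE//; apply: le_lt_trans NS _; rewrite ltey.
have main : (\int[lmeas w]_(y in B) `|u y - ball_mean (lmeas w) B u|%:E <=
    (8 * r)%:E * N)%E.
  apply/lee_addgt0Pr => e e0.
  (* Chosen so that after the factors 2 and 2r the error is exactly [e]. *)
  have e40 : 0 < e / (4 * r) by rewrite divr_gt0//; lra.
  have [c Hc] := box_oscillation w01 r0 e40 mu_ rho0 mrho ug (esym (fineK Nf)).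
  apply: le_trans (mean_oscillation c (measurable_mball x r)
    (lmeas_ball_gt0 x w01 r0) (iu x r r0)) _.
  apply: (@le_trans _ _ (2%:E * ((2 * fine N + e / (4 * r)) * (2 * r))%:E)%E).
    apply: lee_wpmul2l => //; apply: le_trans Hc.
    apply: (@ball_integral_le w x r (fun y => `|u y - c|%:E)) => //.
    by apply/measurable_EFinP; apply: measurableT_comp => //; exact: measurable_funB.
  rewrite -(fineK Nf) -!EFinM -EFinD lee_fin.
  rewrite le_eqVlt; apply/orP; left; apply/eqP; field.
  by rewrite gt_eqF.
apply: (@le_trans _ _ ((ballm w x r)^-1%:E * ((8 * r)%:E * N))%E).
  by apply: lee_wpmul2l main; rewrite lee_fin invr_ge0 ltW.
rewrite muleA -EFinM; apply: lee_pmul => //.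
  by rewrite lee_fin mulr_ge0 ?invr_ge0; lra.
have H : (ballm w x r)^-1 <= D / ballm w x (5 * r).
  by rewrite ler_pdivlMr// mulrC ler_pdivrMr//; exact: ballm_le.
rewrite lee_fin (_ : 8 * D * r / _ = D / ballm w x (5 * r) * (8 * r)); last by ring.
by apply: ler_wpM2r => //; lra.
Qed.

End PoincareBalls.

Theorem theorem1p1 (R : realType) :
  exists (d : measure_display) (X : measurableType d) (dist : X -> X -> R)
         (mu : R -> {measure set X -> \bar R}),
    [/\ is_metric dist /\ borel_for dist, mcompact dist, mgeodesic dist,
        (forall w : R, 0 < w < 1 ->
           [/\ mu w setT = 1%E, doubling dist (mu w) & poincare11 dist (mu w)]) &
        (forall w w' : R, 0 < w < 1 -> 0 < w' < 1 -> w != w' ->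
           mutually_singular (mu w) (mu w'))].
Proof.
exists _, (@lspace R), (@ldist R), (fun w => lmeas w); split.
- by split; [exact: ldist_metric|exact: lspace_borel].
- exact: ldist_compact.
- exact: ldist_geodesic.
- move=> w w01; split; [exact: probability_setT|exact: lmeas_doubling|
    exact: lmeas_poincare].
- by move=> w w' w01 w'01 ww'; exact: lmeas_singular.
Qed.
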